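(* Assume $d\ge 3$. Then for every $x\in\mathbb{Z}^d$, $\mu(|\mathcal{C}_x|<\infty)=1$, where $\mathcal{C}_x(\eta)=\{y\in\mathbb{Z}^d: N(x,y,\eta)>0\}$ is the avalanche cluster caused by adding a grain at $x$.
   Context: Abelian sandpile on $\mathbb{Z}^d$: $\Delta_{xx}=2d$, $\Delta_{xy}=-1$ if $|x-y|=1$, $0$ otherwise; $\Delta_V$ is its restriction to $V\times V$ for finite $V$. $\Omega=\{1,\dots,2d\}^{\mathbb{Z}^d}$ (product topology), $\Omega_V=\{1,\dots,2d\}^V$. For finite $V$, toppling $z\in V$ maps $\xi$ to $\xi-(\Delta_V)_{z\cdot}$, legal if $\xi(z)>2d$; stabilization means performing legal topplings until the configuration is stable (i.e. all heights $\le 2d$); the addition operator is $a_{x,V}\xi$ = stabilization of $\xi+\delta_x$. The recurrent set $\mathcal{R}_V\subset\Omega_V$ is the set of recurrent states of the Markov chain on $\Omega_V$ which at each step applies $a_{X,V}$ with $X$ drawn i.i.d. from a fixed strictly positive distribution on $V$; $\mu_V$ is the uniform measure on $\mathcal{R}_V$. It is known that $\mu_V$ converges weakly (as $V\uparrow\mathbb{Z}^d$) to a probability measure $\mu$ on $\Omega$. For $\eta\in\Omega$ and finite $V\ni x$, $N_V(x,y,\eta)$ is the number of topplings at $y$ needed to stabilize $\eta_V+\delta_x$ in $V$ (grains leaving $V$ disappear); it is non-decreasing in $V$, and $N(x,y,\eta)=\sup_V N_V(x,y,\eta)\in\{0,1,\dots,\infty\}$. *)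

(* Defs.v *)
From HB Require Import structures.
From mathcomp Require Import all_boot all_order all_algebra.
From mathcomp Require Import finmap.
From mathcomp Require Import boolp classical_sets functions cardinality reals ereal
  topology normedtype sequences measure probability.
Set Implicit Arguments. Unset Strict Implicit. Unset Printing Implicit Defensive.
Import Order.TTheory GRing.Theory Num.Theory.

Local Open Scope ring_scope.

(** int is pointed (by 0), so configuration spaces are pointed types. *)
HB.instance Definition _ := isPointed.Build int 0.

Definition site (d : nat) := {ffun 'I_d -> int}.

(** Height configurations (integer valued, to allow subtraction). *)
Notation config d := (site d -> int).

Definition adj d (x y : site d) : bool :=
  (\sum_(i < d) `|x i - y i|)%N == 1%N.

Definition Delta d (x y : site d) : int :=
  if x == y then (2 * d)%:Z else if adj x y then -1 else 0.

(** Toppling of z in the finite volume V: xi |-> xi - (Delta_V)_{z.};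
    heights outside V are untouched (grains leaving V disappear). *)
Definition topple d (V : {fset site d}) (z : site d) (xi : config d) : config d :=
  fun y => if y \in V then xi y - Delta z y else xi y.

Definition topple_seq d (V : {fset site d}) (xi : config d) (s : seq (site d)) :=
  foldl (fun c z => topple V z c) xi s.

Fixpoint legal_seq d (V : {fset site d}) (xi : config d) (s : seq (site d)) : Prop :=
  match s with
  | [::] => True
  | z :: s' => z \in V /\ (2 * d)%:Z < xi z /\ legal_seq V (topple V z xi) s'
  end.

Definition stable_in d (V : {fset site d}) (xi : config d) : Prop :=
  forall y, y \in V -> xi y <= (2 * d)%:Z.

Definition stabilizing d (V : {fset site d}) (xi : config d) : set (seq (site d)) :=
  fun s => legal_seq V xi s /\ stable_in V (topple_seq V xi s).

(** A chosen stabilizing toppling sequence (by the abelian property, the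
    resulting configuration and toppling numbers do not depend on the choice). *)
Definition stab_seq d (V : {fset site d}) (xi : config d) : seq (site d) :=
  xget [::] (stabilizing V xi).

Definition stabilize d (V : {fset site d}) (xi : config d) : config d :=
  topple_seq V xi (stab_seq V xi).

Definition delta d (x : site d) : config d := fun y => if y == x then 1 else 0.

Definition addc d (xi zeta : config d) : config d := fun y => xi y + zeta y.

Definition addop d (V : {fset site d}) (x : site d) (xi : config d) : config d :=
  stabilize V (addc xi (delta x)).

Definition in_OmegaV d (V : {fset site d}) (xi : config d) : Prop :=
  (forall y, y \in V -> 1 <= xi y <= (2 * d)%:Z) /\
  (forall y, y \notin V -> xi y = 0).

(** One step of the Markov chain with positive probability: apply a_{x,V}
    for some x in V (the distribution of X is strictly positive on V). *)
Definition chain_step d (V : {fset site d}) (xi xi' : config d) : Prop :=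
  exists2 x, x \in V & xi' = addop V x xi.

Inductive reach d (V : {fset site d}) : config d -> config d -> Prop :=
  | reach_refl xi : reach V xi xi
  | reach_step xi xi' xi'' : chain_step V xi xi' -> reach V xi' xi'' -> reach V xi xi''.

Definition recurrent d (V : {fset site d}) (xi : config d) : Prop :=
  in_OmegaV V xi /\ forall xi', reach V xi xi' -> reach V xi' xi.

(** Omega_V as a finite type: heights k+1, k : 'I_(2d). *)
Definition OmegaV d (V : {fset site d}) := {ffun V -> 'I_(2 * d)}.

Definition embV d (V : {fset site d}) (xi : OmegaV V) : config d :=
  fun y => match insub y with
           | Some y' => ((xi y' : nat).+1)%:Z
           | None => 0
           end.

Definition RV d (V : {fset site d}) : {set OmegaV V} :=
  [set xi | `[< recurrent V (embV xi) >]].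

Definition muV_cyl (R : realType) d (V : {fset site d}) (A : {fset site d})
    (sigma : config d) : R :=
  (#|[set xi in RV V | `[< forall a, a \in A -> embV xi a = sigma a >]]|%:R
   / #|RV V|%:R).

Definition cylinder d (A : {fset site d}) (sigma : config d) : set (config d) :=
  [set eta | forall a, a \in A -> eta a = sigma a].

Definition cylinders d : set (set (config d)) :=
  [set C | exists A sigma, C = cylinder A sigma].

Notation Omega_meas d := (g_sigma_algebraType (@cylinders d)).

Definition exhausting d (Vn : nat -> {fset site d}) : Prop :=
  (forall n, Vn n `<=` Vn n.+1)%fset /\ (forall y, exists n, y \in Vn n).

Definition restrict d (V : {fset site d}) (eta : config d) : config d :=
  fun y => if y \in V then eta y else 0.

Definition NV d (V : {fset site d}) (x y : site d) (eta : config d) : nat :=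
  count_mem y (stab_seq V (addc (restrict V eta) (delta x))).

Definition Ntop (R : realType) d (x y : site d) (eta : config d) : \bar R :=
  ereal_sup [set ((NV V x y eta)%:R)%:E | V in [set V : {fset site d} | x \in V]].

Definition aval_cluster (R : realType) d (x : site d) (eta : config d) : set (site d) :=
  [set y | (0 < Ntop R x y eta)%E].

(* Main.v *)
(** In a finite box [V] around [x], an avalanche started at [x] decomposes into
    waves (topple [x] once, then stabilize the rest).  The configuration just
    before a wave, restricted to [V] minus [x], has no forbidden subconfiguration
    and determines the recurrent configuration the avalanche started from, so it
    suffices to bound the number of configurations on [V] minus [x] whose wave
    goes beyond distance [N], relative to the number of recurrent configurations.

    The wave is explored one edge at a time, as in the argument of Lyons, Morris
    and Schramm for the ends of the wired spanning forest: with [K] the set of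
    sites known to topple, revealing whether an edge from [K] to a site [y]
    makes [y] topple is deletion-contraction for the determinant that counts
    the configurations compatible with the past.  The effective conductance
    [M] from [K] to the complement of [V], in the graph without the edges that
    failed, is then a nonnegative martingale.  When [K] first reaches a new
    distance at [y], the next edge outwards leads to a site from which a whole
    orthant avoids [K]; as [d >= 3], the flow of Polya's urn in that orthant has
    finite energy, so that if [M] is bounded the harmonic function is bounded
    below there, and revealing that edge makes [sqrt M] drop by a definite amount
    in expectation.  This cannot happen often, hence [K] rarely gets far, uniformly
    in [V].  The total number of configurations is [M] at the start times the
    number of configurations on [V] minus [x], and [M] is bounded below at the
    start by the same orthant argument. *)
Require Import Defs.
From HB Require Import structures.
From mathcomp Require Import all_boot all_order all_algebra.
From mathcomp Require Import boolp ring lra zify.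
Set Implicit Arguments. Unset Strict Implicit. Unset Printing Implicit Defensive.
Import Order.TTheory GRing.Theory Num.Theory.

Local Open Scope ring_scope.

(** * Determinants of Dirichlet Laplacians *)

Section Graph.
Variables (R : rcfType) (T : finType) (e : rel T).
Hypotheses (e_sym : symmetric e) (e_irr : irreflexive e).
Implicit Types (U F : {set T}) (D : T -> nat) (h g u : T -> R).

Definition gdeg U z : nat := (\sum_(w in U) e z w)%N.

(** The diagonal [D] is kept apart from the degree: edges leading out of [U] enter only through [D],
    so deleting one of them lowers [D z] and changes nothing else. *)
Definition lapU U D h z : R := (D z)%:R * h z - \sum_(w in U) (e z w)%:R * h w.

(* Deletion of an edge between [y] and the explored set. *)
Definition decr D y : T -> nat := fun z => if z == y then (D z).-1 else D z.

(* Rows and columns outside [U] are those of the identity, so that all these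
   matrices have the same size and [lap_det U D] is the minor indexed by [U]. *)
Definition lap_mx U D : 'M[R]_#|T| := \matrix_(i, j)
  if (enum_val i \in U) && (enum_val j \in U)
  then (D (enum_val i) * (i == j))%:R - (e (enum_val i) (enum_val j))%:R
  else (i == j)%:R.

Definition lap_det U D : R := \det (lap_mx U D).

Lemma lap_det0 D : lap_det set0 D = 1.
Proof.
rewrite /lap_det (_ : lap_mx _ _ = 1%:M) ?det1 //.
by apply/matrixP => i j; rewrite !mxE inE.
Qed.

Lemma lap_detD1 U D y : lap_det (U :\ y) D =
  cofactor (lap_mx U D) (enum_rank y) (enum_rank y).
Proof.
rewrite /lap_det (expand_det_row _ (enum_rank y)) (bigD1 (enum_rank y)) //=.
rewrite big1 ?addr0 => [|j /negbTE nj]; last first.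
  by rewrite !mxE enum_rankK !inE eqxx /= eq_sym nj mul0r.
rewrite !mxE enum_rankK !inE !eqxx /= mul1r.
congr (_ * \det _); apply/matrixP => i j; rewrite !mxE !inE.
have nz k : (enum_val (lift (enum_rank y) k) == y) = false.
  apply/negbTE; apply/eqP => E; have := neq_lift (enum_rank y) k.
  by rewrite -{1}E enum_valK eqxx.
by rewrite !nz.
Qed.

(** Deletion-contraction: the determinant is affine in the diagonal entry at [y], with slope the
    minor that omits [y]. *)
Lemma lap_det_decr U D y : y \in U -> (0 < D y)%N ->
  lap_det U D = lap_det U (decr D y) + lap_det (U :\ y) D.
Proof.
move=> yU Dy; rewrite lap_detD1 /lap_det.
rewrite (expand_det_row _ (enum_rank y)) [in RHS](expand_det_row _ (enum_rank y)).
rewrite (bigD1 (enum_rank y)) //= [in RHS](bigD1 (enum_rank y)) //=.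
have cof j : cofactor (lap_mx U (decr D y)) (enum_rank y) j =
             cofactor (lap_mx U D) (enum_rank y) j.
  congr (_ * \det _); apply/matrixP => a b; rewrite !mxE /decr.
  have -> // : (enum_val (lift (enum_rank y) a) == y) = false.
  apply/negbTE; apply/eqP => E; have := neq_lift (enum_rank y) a.
  by rewrite -{1}E enum_valK eqxx.
under [in RHS]eq_bigr => j nj.
  rewrite cof (_ : lap_mx U (decr D y) (enum_rank y) j = lap_mx U D (enum_rank y) j); last first.
    by rewrite !mxE eq_sym (negbTE nj) !muln0.
  over.
rewrite cof !mxE enum_rankK yU !eqxx /= /decr eqxx e_irr !muln1 !subr0.
rewrite -{1}(prednK Dy) -addn1 natrD mulrDl mul1r -!addrA; congr (_ + _).
by rewrite addrC.
Qed.

Lemma lap_mx_row U D u y : y \in U -> (forall z, z \notin U -> u z = 0) ->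
  \sum_j lap_mx U D (enum_rank y) j * u (enum_val j) = lapU U D u y.
Proof.
move=> yU u0.
rewrite (reindex (fun z : T => enum_rank z)) /=; last first.
  by exists enum_val => ? _; rewrite ?enum_rankK ?enum_valK.
rewrite /lapU (bigID (mem U)) /= [X in _ + X]big1 ?addr0; last first.
  by move=> i /u0; rewrite enum_rankK => ->; rewrite mulr0.
under eq_bigr => z zU.
  rewrite !mxE !enum_rankK yU zU /= mulrBl; over.
rewrite sumrB; congr (_ - _).
rewrite (bigD1 y) //= eqxx muln1 big1 ?addr0 // => z /andP[_ /negbTE nz].
by rewrite (inj_eq enum_rank_inj) eq_sym nz muln0 mul0r.
Qed.

(** [g] is the column of the inverse matrix at [y], and by Cramer's rule [g y] is a ratio of minors.
    It will be the conditional probability that a revealed edge makes [y] topple. *)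
Lemma lap_green U D y : y \in U -> lap_det U D != 0 ->
  exists g : T -> R, [/\ forall z, z \notin U -> g z = 0,
    forall z, z \in U -> lapU U D g z = (z == y)%:R &
    lap_det (U :\ y) D = g y * lap_det U D].
Proof.
move=> yU nz.
pose A := lap_mx U D.
pose g z := if z \in U then \adj A (enum_rank z) (enum_rank y) / \det A else 0.
exists g; split => [z /negbTE zU|z zU|]; first by rewrite /g zU.
- rewrite -lap_mx_row //; last by move=> w /negbTE wU; rewrite /g wU.
  have := congr1 (fun M : 'M[R]_#|T| => M (enum_rank z) (enum_rank y)) (mul_mx_adj A).
  rewrite !mxE (inj_eq enum_rank_inj) => E.
  apply: (mulIf nz); rewrite -mulr_natl in E; rewrite -{}E mulr_suml.
  apply: eq_bigr => j _; rewrite /g; case: ifPn => jU.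
    by rewrite enum_valK /lap_det -/A -mulrA divfK.
  rewrite mulr0 mul0r /A mxE enum_rankK (negbTE jU) andbF.
  rewrite (_ : (_ == _) = false) ?mul0r //.
  by apply/eqP => E; move: jU; rewrite -E enum_rankK zU.
- by rewrite lap_detD1 /g yU mxE /lap_det divfK.
Qed.

Lemma lap_unique U D u : lap_det U D != 0 -> (forall z, z \notin U -> u z = 0) ->
  (forall z, z \in U -> lapU U D u z = 0) -> forall z, u z = 0.
Proof.
move=> nz u0 Lu z; pose v : 'cV[R]_#|T| := \col_j u (enum_val j).
have Av : lap_mx U D *m v = 0.
  apply/matrixP => i j; rewrite !mxE.
  under eq_bigr do rewrite [v _ _]mxE.
  have [iU|iU] := boolP (enum_val i \in U).
    by rewrite -(enum_valK i) lap_mx_row ?Lu.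
  rewrite big1 // => k _; rewrite mxE (negbTE iU) /=.
  by have [<-|] := eqVneq i k; rewrite ?mul0r // u0 ?mulr0.
have := congr1 (fun B => (\adj (lap_mx U D) *m B) (enum_rank z) 0) Av.
rewrite mulmxA mul_adj_mx mulmx0 mul_scalar_mx !mxE enum_rankK => /eqP.
by rewrite mulf_eq0 (negbTE nz) => /eqP.
Qed.

(** The indicator of [F] is a nonzero kernel vector. In use, all the edges at sites of [F] stay
    inside [F]. *)
Lemma lap_det_closed U D F : F \subset U -> F != set0 ->
  (forall z, z \in U -> lapU U D (fun w => (w \in F)%:R) z = 0) -> lap_det U D = 0.
Proof.
move=> FU /set0Pn[z zF] LF; apply/eqP/negP => /negP nz.
suff /eqP : (z \in F)%:R = 0 :> R by rewrite zF oner_eq0.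
apply: (lap_unique nz _ LF z) => w wU; rewrite (_ : w \in F = false) //.
by apply/negP => /(subsetP FU); apply/negP.
Qed.

End Graph.

(** * Counting configurations without forbidden subconfigurations *)

Section Allowed.
Variables (R : rcfType) (T : finType) (e : rel T) (q : nat).
Hypotheses (e_sym : symmetric e) (e_irr : irreflexive e).
Implicit Types (U F : {set T}) (D : T -> nat) (h : {ffun T -> 'I_q}).
Local Notation gdeg := (gdeg e).
Local Notation lap_det := (lap_det R e).

(* [h z] encodes the height [h z + 1].  Outside [U] the configuration is frozen to
   [h0]: the heights of the sites that are known to topple are no longer free, and
   the configurations compatible with a past are again of this form. *)
Definition allowed U D h0 : {set {ffun T -> 'I_q}} :=
  [set h : {ffun T -> 'I_q} | [&& [forall z, (z \notin U) ==> (h z == h0 z)],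
    [forall z in U, (h z < D z)%N] &
    [forall F : {set T}, (F \subset U) && (F != set0) ==>
       [exists y in F, (gdeg F y <= h y)%N]]]].

Lemma allowedP U D h0 h : reflect
  [/\ forall z, z \notin U -> h z = h0 z, forall z, z \in U -> (h z < D z)%N &
      forall F : {set T}, F \subset U -> F != set0 -> exists2 y, y \in F & (gdeg F y <= h y)%N]
  (h \in allowed U D h0).
Proof.
rewrite inE; apply: (iffP and3P) => [[/forallP H1 /forall_inP H2 /forallP H3]|[H1 H2 H3]].
  split=> // [z zU|F FU F0].
    by have /implyP/(_ zU)/eqP := H1 z.
  by have := H3 F; rewrite FU F0 => /exists_inP.
split; first by apply/forallP => z; apply/implyP => /H1 ->.
  exact/forall_inP.
apply/forallP => F; apply/implyP => /andP[FU F0]; apply/exists_inP; exact: H3.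
Qed.

Definition upd h y (v : 'I_q) : {ffun T -> 'I_q} :=
  [ffun z => if z == y then v else h z].

Lemma gdegS U F y : F \subset U -> (gdeg F y <= gdeg U y)%N.
Proof.
move=> FU; rewrite /gdeg [X in (_ <= X)%N](big_setID F) /= (setIidPr FU).
exact: leq_addr.
Qed.

(** Separate [h y = v], the largest value permitted, from [h y < v]. In the first case [y] meets the
    condition of every [F] containing it, so it can be frozen and removed from [U]. The event [E] is
    carried along for use with [far]. *)
Lemma card_allowed_split U D h0 y (v : 'I_q) (E : {set {ffun T -> 'I_q}}) :
  y \in U -> D y = v.+1 -> (gdeg U y <= v)%N ->
  #|allowed U D h0 :&: E| =
    (#|allowed U (decr D y) h0 :&: E| + #|allowed (U :\ y) D (upd h0 y v) :&: E|)%N.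
Proof.
move=> yU Dy dy; rewrite -cardsUI [X in (_ + X)%N](_ : _ = 0%N) ?addn0.
  rewrite -setIUl; congr #|pred_of_set (_ :&: _)|; apply/setP => h; rewrite ?in_setU ?in_set1.
  apply/idP/orP => [/allowedP[H1 H2 H3]|[]/allowedP[H1 H2 H3]].
  - have := H2 y yU; rewrite Dy ltnS leq_eqVlt => /orP[/eqP hv|hv].
      right; apply/allowedP; split=> [z|z|F].
      + rewrite !inE negb_and negbK => /orP[/eqP->|zU].
          by rewrite ffunE eqxx; apply/val_inj.
        by rewrite ffunE H1 //; case: eqVneq => // E0; move: zU; rewrite E0 yU.
      + by rewrite inE => /andP[_ /H2].
      + by move=> FU; apply: H3; apply: subset_trans FU (subD1set _ _).
    left; apply/allowedP; split=> // z zU; rewrite /decr; case: eqVneq => [->|_].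
      by rewrite Dy.
    exact: H2.
  - apply/allowedP; split=> // z zU; apply: leq_trans (H2 z zU) _.
    by rewrite /decr; case: ifP => // _; apply: leq_pred.
  - have hy : h y = v by rewrite H1 ?ffunE ?eqxx // !inE eqxx.
    apply/allowedP; split=> [z zU|z zU|F FU F0].
    + rewrite H1 ?ffunE; last by rewrite !inE negb_and zU orbT.
      by case: eqVneq => // E0; move: zU; rewrite E0 yU.
    + have [->|zy] := eqVneq z y; first by rewrite Dy hy.
      by apply: H2; rewrite !inE zy.
    + have [yF|yF] := boolP (y \in F).
        by exists y => //; rewrite hy (leq_trans _ dy) // gdegS.
      by apply: H3 => //; rewrite subsetD1 FU.
apply/eqP; rewrite cards_eq0; apply/set0Pn => -[h].
rewrite !inE => /andP[/andP[H1 _] /andP[H2 _]].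
have {}H1 : h \in allowed U (decr D y) h0 by rewrite inE.
have {}H2 : h \in allowed (U :\ y) D (upd h0 y v) by rewrite inE.
case/allowedP: H1 => _ /(_ y yU) + _; rewrite /decr eqxx Dy.
case/allowedP: H2 => /(_ y) + _ _; rewrite !inE eqxx => /(_ isT) ->.
by rewrite ffunE eqxx ltnn.
Qed.

Lemma weight_decr U D y : y \in U -> (0 < D y)%N ->
  (\sum_(z in U) decr D y z).+1 = (\sum_(z in U) D z)%N.
Proof.
move=> yU Dy; rewrite (bigD1 y) //= [RHS](bigD1 y) //= /decr eqxx -addSn prednK //.
by congr (_ + _)%N; apply: eq_bigr => z /andP[_ /negbTE ->].
Qed.

Lemma weight_setD1 U D y : y \in U -> (0 < D y)%N ->
  (\sum_(z in U :\ y) D z < \sum_(z in U) D z)%N.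
Proof.
move=> yU Dy; rewrite [X in (_ < X)%N](bigD1 y) //=.
rewrite (eq_bigl (fun z => (z \in U) && (z != y))) => [|z]; last by rewrite !inE andbC.
by rewrite -[X in (X < _)%N]add0n ltn_add2r.
Qed.

(** Count and determinant obey the same deletion-contraction recursion; the induction is on the
    total of [D]. *)
Lemma card_allowed U D h0 :
  (forall z, z \in U -> (gdeg U z <= D z <= q)%N) ->
  #|allowed U D h0|%:R = lap_det U D.
Proof.
have [n] := ubnP (\sum_(z in U) D z)%N.
elim: n U D h0 => // n IH U D h0; rewrite ltnS => leU H.
have [->|U0] := eqVneq U set0.
  rewrite lap_det0 (_ : allowed _ _ _ = [set h0]) ?cards1 //; apply/setP => h.
  rewrite in_set1; apply/allowedP/eqP => [[H1 _ _]|->].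
    by apply/ffunP => z; rewrite H1 ?inE.
  by split=> // [z|F]; rewrite ?inE // subset0 => /eqP -> /eqP.
have [/exists_inP[y yU dy]|/exists_inPn noy] := boolP [exists y in U, (gdeg U y < D y)%N].
  have /andP[_ Dq] := H y yU.
  have vq : ((D y).-1 < q)%N by rewrite prednK // (leq_ltn_trans _ dy).
  have Dy0 : (0 < D y)%N by apply: leq_ltn_trans dy.
  have := @card_allowed_split U D h0 y (Ordinal vq) setT yU.
  rewrite !setIT /= prednK // -ltnS prednK // => ->//.
  rewrite natrD (lap_det_decr R e_irr yU Dy0) !IH //.
  + exact: leq_trans (weight_setD1 yU Dy0) leU.
  + move=> z; rewrite inE => /andP[_ zU]; have /andP[H1 ->] := H z zU.
    by rewrite (leq_trans _ H1) // gdegS // subD1set.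
  + by rewrite weight_decr.
  + move=> z zU; have /andP[H1 H2] := H z zU; rewrite /decr; case: eqVneq => [->|_].
      by rewrite -ltnS prednK // dy (leq_trans (leq_pred _)).
    by rewrite H1.
(* No diagonal entry can be lowered any more, and both sides vanish: the determinant because the
   indicator of [U] is in the kernel, the count because [U] itself is forbidden. *)
have Deq z : z \in U -> D z = gdeg U z.
  move=> zU; apply/eqP; rewrite eqn_leq leqNgt noy //=.
  by have /andP[] := H z zU.
rewrite (_ : allowed _ _ _ = set0) ?cards0.
  rewrite (@lap_det_closed R T e U D U) // => z zU.
  rewrite /lapU zU mulr1 Deq // /gdeg natr_sum -sumrB big1 // => w ->.
  by rewrite mulr1 subrr.
apply/setP => h; rewrite in_set0; apply/negbTE/negP => /allowedP[_ H2 /(_ U (subxx _) U0)].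
by case=> y yU; rewrite leqNgt -Deq // H2.
Qed.

End Allowed.

(** * Harmonic functions and effective conductance *)

Section Harmonic.
Variables (R : rcfType) (T : finType) (e : rel T) (beta : T -> nat) (q : nat).
Hypotheses (e_sym : symmetric e) (e_irr : irreflexive e).
Implicit Types (U F : {set T}) (D : T -> nat) (h g u : T -> R).
Local Notation gdeg := (gdeg e).
Local Notation lapU := (lapU e).
Local Notation lap_det := (lap_det R e).

(* The graph is seen as an electrical network: the sink has voltage 1, to which [z]
   is joined by [beta z] edges, and the complement of [U] is a single vertex of
   voltage 0, to which [z] is joined by the [live U D z] edges not yet deleted. *)
Definition valid U D := forall z, z \in U -> (gdeg U z + beta z <= D z <= q)%N.

Definition live U D z : R := (D z)%:R - (gdeg U z)%:R - (beta z)%:R.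

Definition harm U D h :=
  (forall z, z \notin U -> h z = 0) /\ (forall z, z \in U -> lapU U D h z = (beta z)%:R).

(* The effective conductance between the complement of [U] and the sink. *)
Definition cond U D h : R :=
  \sum_(z | z \notin U) (beta z)%:R + \sum_(z in U) live U D z * h z.

Lemma live_ge0 U D z : valid U D -> z \in U -> 0 <= live U D z.
Proof.
by move=> V /V /andP[H _]; rewrite /live -addrA -opprD -natrD subr_ge0 ler_nat.
Qed.

Lemma lapU_sym U D u h :
  \sum_(z in U) u z * lapU U D h z = \sum_(z in U) h z * lapU U D u z.
Proof.
rewrite /lapU; under eq_bigr do rewrite mulrBr.
under [in RHS]eq_bigr do rewrite mulrBr.
rewrite !sumrB; congr (_ - _); first by apply: eq_bigr => z _; ring.
under eq_bigr do rewrite mulr_sumr; under [in RHS]eq_bigr do rewrite mulr_sumr.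
rewrite exchange_big /=; apply: eq_bigr => z _; apply: eq_bigr => w _.
by rewrite e_sym; ring.
Qed.

Lemma lapU_lin U D u h (c : R) z :
  lapU U D (fun w => u w + c * h w) z = lapU U D u z + c * lapU U D h z.
Proof.
rewrite /lapU mulrBr mulr_sumr.
under eq_bigr do rewrite mulrDr (mulrCA _ c).
by rewrite big_split /=; ring.
Qed.

Lemma lapU1 U D z : lapU U D (fun=> 1) z = live U D z + (beta z)%:R.
Proof.
rewrite /lapU /live /gdeg natr_sum mulr1 addrNK; congr (_ - _).
by apply: eq_bigr => w _; rewrite mulr1.
Qed.

Lemma lapU_shift U D u (c : R) z : lapU U D u z =
  ((D z)%:R - (gdeg U z)%:R) * c + lapU U D (fun w => u w - c) z.
Proof.
have := lapU_lin U D u (fun=> 1) (- c) z; rewrite lapU1 /live.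
rewrite (_ : lapU U D (fun w => u w + - c * 1) z = lapU U D (fun w => u w - c) z); last first.
  by congr (lapU _ _ _ _); apply/funext => w; rewrite mulr1.
by move=> ->; ring.
Qed.

(** At a negative minimum [m] every term of [lapU_shift] must vanish, so the set where [u] equals
    [m] is closed under adjacency and has [D] equal to [gdeg U]; its indicator would be in the
    kernel. *)
Lemma lapU_min U D u : valid U D -> lap_det U D != 0 ->
  (forall z, z \in U -> 0 <= lapU U D u z) -> forall z, z \in U -> 0 <= u z.
Proof.
move=> V nz Lu z0 z0U; rewrite leNgt; apply/negP => uz0.
have [z1 z1U minz] : exists2 z1, z1 \in U & forall w, w \in U -> u z1 <= u w.
  by exists [arg min_(z < z0 in U) u z]%O; case: arg_minP.
set m := u z1 in minz.
have m0 : m < 0 by apply: le_lt_trans (minz _ z0U) uz0.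
pose F := [set z in U | u z == m].
have memF z : z \in F -> z \in U /\ u z = m by rewrite inE => /andP[? /eqP].
have key z : z \in F -> (D z)%:R = (gdeg U z)%:R :> R /\
    forall w, w \in U -> e z w -> w \in F.
  move=> /memF[zU uz]; have := Lu z zU; rewrite (lapU_shift U D u m).
  rewrite {1}/lapU /= uz subrr mulr0 sub0r.
  have A0 : ((D z)%:R - (gdeg U z)%:R) * m <= 0.
    rewrite mulr_ge0_le0 ?(ltW m0) // subr_ge0 ler_nat.
    by have /andP[H _] := V z zU; rewrite (leq_trans _ H) ?leq_addr.
  have S0 w : w \in U -> 0 <= (e z w)%:R * (u w - m).
    by move=> wU; rewrite mulr_ge0 // subr_ge0 minz.
  have S0' : 0 <= \sum_(w in U) (e z w)%:R * (u w - m) by apply: sumr_ge0.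
  move=> H; have S1 : \sum_(w in U) (e z w)%:R * (u w - m) = 0 by lra.
  have A1 : ((D z)%:R - (gdeg U z)%:R) * m = 0 by lra.
  split.
    by move/eqP: A1; rewrite mulf_eq0 (lt_eqF m0) orbF subr_eq0 => /eqP.
  move=> w wU ezw; rewrite inE wU /=.
  have /psumr_eq0P := S1; move/(_ S0)/(_ w wU); rewrite ezw mul1r => /eqP.
  by rewrite subr_eq0.
have FU : F \subset U by apply/subsetP => z /memF[].
move/eqP: nz; apply; apply: (@lap_det_closed R T e U D F) => //.
  by apply/set0Pn; exists z1; rewrite inE z1U eqxx.
move=> z zU; rewrite /lapU.
have [zF|zF] := boolP (z \in F).
  have [-> H] := key z zF; rewrite mulr1 /gdeg natr_sum -sumrB big1 // => w wU.
  by have [ezw|] := boolP (e z w); rewrite ?mul0r ?subrr // (H w wU ezw) mulr1 subrr.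
rewrite mulr0 sub0r big1 ?oppr0 // => w wU.
have [wF|] := boolP (w \in F); last by rewrite mulr0.
have [_ /(_ z zU)] := key w wF; rewrite e_sym.
by case: (e z w) zF => [/negbTE -> /(_ isT)|] //; rewrite mul0r.
Qed.

Lemma harm_ge0 U D h : valid U D -> lap_det U D != 0 -> harm U D h ->
  forall z, 0 <= h z.
Proof.
move=> V nz [h0 hL] z; have [zU|/h0 -> //] := boolP (z \in U).
by apply: (lapU_min V nz) zU => w /hL ->.
Qed.

Lemma cond_ge0 U D h : valid U D -> lap_det U D != 0 -> harm U D h -> 0 <= cond U D h.
Proof.
move=> V nz H; rewrite addr_ge0 ?sumr_ge0 // => z zU.
by rewrite mulr_ge0 ?(live_ge0 V zU) ?(harm_ge0 V nz H).
Qed.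

Lemma harm_exists U D : lap_det U D != 0 -> exists h, harm U D h.
Proof.
move=> nz.
have /choice[G HG] y : exists g : T -> R, (forall z, z \notin U -> g z = 0) /\
    (y \in U -> forall z, z \in U -> lapU U D g z = (z == y)%:R).
  have [yU|] := boolP (y \in U); last by exists (fun=> 0).
  by have [g [? ? _]] := lap_green yU nz; exists g.
exists (fun z => \sum_(y in U) (beta y)%:R * G y z); split=> z zU.
  by rewrite big1 // => y _; rewrite (HG y).1 ?mulr0.
rewrite /lapU; under [X in _ - X]eq_bigr do rewrite mulr_sumr.
rewrite exchange_big /= mulr_sumr -sumrB (bigD1 z) //= [X in _ + X]big1 ?addr0 => [|y /andP[yU nyz]].
  under eq_bigr do rewrite mulrCA.
  rewrite -mulr_sumr mulrCA -mulrBr.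
  by rewrite [X in _ * X](_ : _ = lapU U D (G z) z) // (HG z).2 // eqxx mulr1.
under eq_bigr do rewrite mulrCA.
rewrite -mulr_sumr mulrCA -mulrBr.
rewrite [X in _ * X](_ : _ = lapU U D (G y) z) // (HG y).2 //.
by rewrite eq_sym (negbTE nyz) mulr0.
Qed.

(** * Effect of one revealed edge on the harmonic function and the conductance *)

Section Step.
Variables (U : {set T}) (D : T -> nat) (y : T) (g h : T -> R).
Hypotheses (yU : y \in U) (g0 : forall z, z \notin U -> g z = 0)
  (gL : forall z, z \in U -> lapU U D g z = (z == y)%:R) (hH : harm U D h).

(** Green's identity for [g] against 1 and against [h]; the [beta] terms cancel in the
    difference. *)
Lemma sum_live_green : \sum_(z in U) live U D z * g z = 1 - h y.
Proof.
have sumE u : \sum_(z in U) u z * lapU U D g z = u y.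
  rewrite (bigD1 y) //= gL // eqxx mulr1 big1 ?addr0 // => z /andP[zU /negbTE nz].
  by rewrite gL // nz mulr0.
have := sumE (fun=> 1); rewrite lapU_sym.
have := sumE h; rewrite lapU_sym => <- <-.
rewrite -sumrB; apply: eq_bigr => z zU; rewrite lapU1 hH.2 //; ring.
Qed.

(** Rank-one update: lowering the entry at [y] adds the multiple [h y / (1 - g y)] of [g] to [h]. *)
Lemma harm_closed : (0 < D y)%N -> g y != 1 ->
  exists2 h', harm U (decr D y) h' &
    cond U (decr D y) h' = cond U D h - h y ^+ 2 / (1 - g y).
Proof.
move=> Dy gy1; have n1 : 1 - g y != 0 by rewrite subr_eq0 eq_sym.
have DyE : (decr D y y)%:R = (D y)%:R - 1 :> R.
  by rewrite /decr eqxx -[in RHS](prednK Dy) -addn1 natrD addrK.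
pose c := h y / (1 - g y); exists (fun z => h z + c * g z).
  split=> z zU; first by rewrite g0 // hH.1 // mulr0 addr0.
  rewrite [LHS](_ : _ = lapU U D (fun w => h w + c * g w) z - (z == y)%:R * (h z + c * g z)).
    rewrite lapU_lin gL // hH.2 //; case: eqVneq => [->|_]; last by rewrite mulr0 mul0r !addr0 subr0.
    by rewrite /c; field.
  rewrite /lapU /=; case: eqVneq => [->|nz]; first by rewrite DyE /=; ring.
  by rewrite /decr (negbTE nz) mul0r subr0.
rewrite /cond -addrA; congr (_ + _).
rewrite (eq_bigr (fun z => live U D z * h z + c * (live U D z * g z)
    - (z == y)%:R * (h z + c * g z))); last first.
  move=> z zU; rewrite /live; case: eqVneq => [->|nz]; first by rewrite DyE /=; ring.
  by rewrite /decr (negbTE nz) /=; ring.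
rewrite sumrB big_split /= -mulr_sumr sum_live_green.
rewrite [X in _ - X](bigD1 y) //= eqxx [X in _ - (_ + X)]big1 ?addr0; last first.
  by move=> z /andP[_ /negbTE ->]; rewrite mul0r.
by rewrite /c /=; field.
Qed.

Lemma gdegD1 z : gdeg U z = (e z y + gdeg (U :\ y) z)%N.
Proof.
rewrite /gdeg (bigD1 y) //=; congr (_ + _)%N.
by apply: eq_bigl => w; rewrite !inE andbC.
Qed.

(** Subtracting the multiple of [g] that makes the value at [y] vanish merges [y] with the vertex of
    voltage 0. *)
Lemma harm_open : g y != 0 ->
  exists2 h', harm (U :\ y) D h' &
    cond (U :\ y) D h' = cond U D h + h y ^+ 2 / g y.
Proof.
move=> gy0; pose c := - (h y / g y).
pose h' z := h z + c * g z.
have h'y : h' y = 0 by rewrite /h' /c; field.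
have LE z : lapU (U :\ y) D h' z = lapU U D h' z.
  rewrite /lapU; congr (_ - _); rewrite [RHS](bigD1 y) //= h'y mulr0 add0r.
  by apply: eq_bigl => w; rewrite !inE andbC.
exists h'.
  split=> z zU.
    have [->//|nz] := eqVneq z y; rewrite /h' g0 ?hH.1 ?mulr0 ?addr0 //.
      by move: zU; rewrite !inE nz.
    by move: zU; rewrite !inE nz.
  move: zU; rewrite !inE => /andP[/negbTE nz zU]; rewrite LE lapU_lin gL // hH.2 //.
  by rewrite nz mulr0 addr0.
have S0 : \sum_(z in U) (e y z)%:R * h' z = - c - (beta y)%:R.
  have : lapU U D h' y = (beta y)%:R + c by rewrite lapU_lin gL // hH.2 // eqxx mulr1.
  rewrite /lapU h'y; lra.
rewrite /cond.
rewrite (bigD1 y) /= ?inE ?eqxx // (eq_bigl (fun z => z \notin U)); last first.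
  by move=> z; rewrite !inE; case: eqVneq => [->|]; rewrite ?yU //= andbT.
rewrite [X in _ + X](_ : _ = \sum_(z in U) (live U D z * h z + c * (live U D z * g z)
    + (e y z)%:R * h' z)).
  rewrite !big_split /= -mulr_sumr sum_live_green S0 /c; field.
  by [].
rewrite [RHS](bigD1 y) //= h'y e_irr mul0r addr0.
rewrite (_ : live U D y * h y + _ = live U D y * h' y); last by rewrite /h'; ring.
rewrite h'y mulr0 add0r; apply: eq_big => [z|z]; first by rewrite !inE andbC.
rewrite !inE => /andP[_ zU]; rewrite /live gdegD1 natrD e_sym /h'; ring.
Qed.

End Step.

(** Summation by parts shows that the left side is the sum of [live U D z * (h z - h z ^+ 2)]. What
    is missing from [cond] is the energy of the live edges and the edges from the explored set
    straight to the sink. The factor 1/2 compensates for counting each edge twice. *)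
Lemma harm_energy U D h : valid U D -> lap_det U D != 0 -> harm U D h ->
  \sum_(z in U) (2^-1 * (\sum_(w in U) (e z w)%:R * (h w - h z) ^+ 2)
     + (beta z)%:R * (1 - h z) ^+ 2) <= cond U D h.
Proof.
move=> V nz H; have [h0 hL] := H.
have E1 : \sum_(z in U) (live U D z + (beta z)%:R) * h z = \sum_(z in U) (beta z)%:R.
  have := lapU_sym U D (fun=> 1) h.
  rewrite (eq_bigr (fun z => (beta z)%:R)) => [->|z zU]; last by rewrite mul1r hL.
  by apply: eq_bigr => z _; rewrite lapU1 mulrC.
have E2 : \sum_(z in U) \sum_(w in U) (e z w)%:R * (h w - h z) ^+ 2 =
    2 * \sum_(z in U) (h z * (beta z)%:R - (live U D z + (beta z)%:R) * h z ^+ 2).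
  rewrite (eq_bigr (fun z => (\sum_(w in U) (e z w)%:R * h w ^+ 2 - (gdeg U z)%:R * h z ^+ 2)
      + 2 * (h z * (beta z)%:R - (live U D z + (beta z)%:R) * h z ^+ 2))) => [|z zU].
    rewrite big_split /= -mulr_sumr sumrB exchange_big /=.
    rewrite [X in X - _ + _](_ : _ = \sum_(z in U) (gdeg U z)%:R * h z ^+ 2).
      by rewrite subrr add0r.
    apply: eq_bigr => z _; rewrite /gdeg natr_sum mulr_suml.
    by apply: eq_bigr => w _; rewrite e_sym.
  rewrite (eq_bigr (fun w => (e z w)%:R * h w ^+ 2 - 2 * h z * ((e z w)%:R * h w)
     + (e z w)%:R * h z ^+ 2)) => [|w _]; last by ring.
  rewrite big_split /= sumrB -mulr_sumr -mulr_suml -natr_sum -/(gdeg U z).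
  have -> : \sum_(w in U) (e z w)%:R * h w = (D z)%:R * h z - (beta z)%:R.
    by rewrite -(hL z zU) /lapU; ring.
  by rewrite /live; ring.
rewrite big_split /= -mulr_sumr E2 mulrA mulVf ?pnatr_eq0 // mul1r.
have -> : \sum_(z in U) (h z * (beta z)%:R - (live U D z + (beta z)%:R) * h z ^+ 2) +
   \sum_(z in U) (beta z)%:R * (1 - h z) ^+ 2 =
   \sum_(z in U) live U D z * h z - \sum_(z in U) live U D z * h z ^+ 2.
  rewrite -big_split /= -sumrB.
  rewrite (eq_bigr (fun z => (beta z)%:R - (live U D z + (beta z)%:R) * h z
      + (live U D z * h z - live U D z * h z ^+ 2))) => [|z _]; last by ring.
  by rewrite big_split /= sumrB E1 subrr add0r.
rewrite /cond lerBlDr -addrA addrC -addrA lerDl addr_ge0 ?sumr_ge0 // => z zU.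
by rewrite mulr_ge0 ?sqr_ge0 ?(live_ge0 V zU).
Qed.

End Harmonic.

(** The function [1 - h - M * g], with [g] the Green function at [x], is killed by the whole
    Laplacian, hence zero; at [x] this reads [M * g x = 1], and [g x] is the ratio of the two
    determinants. *)
Lemma lap_det_setT (R : rcfType) (T : finType) (e : rel T) (beta : T -> nat) (q : nat) (x : T)
    (h : T -> R) : symmetric e -> irreflexive e ->
  (forall z, (gdeg e setT z + beta z = q)%N) ->
  harm e beta (setT :\ x) (fun=> q) h -> lap_det R e setT (fun=> q) != 0 ->
  lap_det R e setT (fun=> q) =
    cond e beta (setT :\ x) (fun=> q) h * lap_det R e (setT :\ x) (fun=> q).
Proof.
move=> e_sym e_irr deg_q [h0 hL] nz.
have [g [_ gL ->]] := lap_green (in_setT x) nz.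
set M := cond _ _ _ _ _.
suff Mg : M * g x = 1 by rewrite mulrA Mg mul1r.
have hx : h x = 0 by apply: h0; rewrite !inE eqxx.
have ME : M = (beta x)%:R + \sum_(w in setT :\ x) (e x w)%:R * h w.
  rewrite /M /cond; congr (_ + _).
    by rewrite (big_pred1 x) // => z; rewrite !inE andbT negbK.
  apply: eq_bigr => w _; congr (_ * _); rewrite /live -(deg_q w) natrD.
  by rewrite (gdegD1 e (in_setT x)) natrD e_sym; ring.
have L0 z : lapU e setT (fun=> q) (fun w => (1 + (-1) * h w) + (- M) * g w) z = 0.
  rewrite !lapU_lin gL ?inE // (lapU1 _ e beta).
  have -> : live R e beta [set: T] (fun=> q) z = 0.
    by rewrite /live -(deg_q z) natrD; ring.
  have hE : lapU e setT (fun=> q) h z = lapU e (setT :\ x) (fun=> q) h z.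
    rewrite /lapU; congr (_ - _); rewrite (bigD1 x) //= hx mulr0 add0r.
    by apply: eq_bigl => w; rewrite !inE andbT.
  rewrite hE; have [->|nzx] := eqVneq z x; last first.
    by rewrite hL ?inE ?nzx //=; ring.
  by rewrite /lapU hx ME mulr1n; ring.
have := lap_unique nz _ (fun z _ => L0 z) x.
rewrite hx => H; suff: 1 + -1 * 0 + - M * g x = 0 by lra.
by apply: H => z; rewrite inE.
Qed.

(** * Exploring the first component *)

(** Jensen's inequality for the square root of the conductance, which moves to two values of mean
    [M]; [t] stands for [h y]. If [p = 1], then [t = 0] and the second branch has weight 0. *)
Lemma sqrt_mix (R : rcfType) (p t M : R) : 0 < p -> p <= 1 - t -> 0 <= t -> 0 <= M ->
  (p != 1 -> 0 <= M - t ^+ 2 / (1 - p)) ->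
  p * Num.sqrt (M + t ^+ 2 / p) + (1 - p) * Num.sqrt (M - t ^+ 2 / (1 - p)) <= Num.sqrt M.
Proof.
move=> p0 pt t0 M0 HM.
have [p1|p1] := eqVneq p 1.
  have -> : t = 0 by lra.
  by rewrite p1 expr0n /= !mul0r addr0 subrr mul0r addr0 mul1r.
have p1' : 0 < 1 - p by rewrite subr_gt0 lt_neqAle p1 /=; lra.
have {}HM := HM p1.
set a := Num.sqrt _; set b := Num.sqrt (M - _); set s := Num.sqrt M.
have a0 : 0 <= a by apply: sqrtr_ge0.
have b0 : 0 <= b by apply: sqrtr_ge0.
have s0 : 0 <= s by apply: sqrtr_ge0.
have a2 : p * a ^+ 2 = p * M + t ^+ 2.
  rewrite /a sqr_sqrtr; last by rewrite addr_ge0 // divr_ge0 ?sqr_ge0 // ltW.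
  by field; rewrite gt_eqF.
have b2 : (1 - p) * b ^+ 2 = (1 - p) * M - t ^+ 2.
  by rewrite /b sqr_sqrtr //; field; rewrite gt_eqF.
have s2 : s ^+ 2 = M by apply: sqr_sqrtr.
have p0' := ltW p0; have p1'' := ltW p1'.
rewrite -(@ler_pXn2r _ 2) ?nnegrE ?addr_ge0 ?mulr_ge0 // s2.
have : 0 <= p * (1 - p) * (a - b) ^+ 2 by rewrite mulr_ge0 ?sqr_ge0 // mulr_ge0 ?ltW.
have -> : p * (1 - p) * (a - b) ^+ 2 =
   p * a ^+ 2 + (1 - p) * b ^+ 2 - (p * a + (1 - p) * b) ^+ 2 by ring.
rewrite a2 b2; lra.
Qed.

(** A lower bound for the defect [p * (a - s) ^+ 2 / (2 * s)] of the next lemma, uniform in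
    [M <= lam] and [t >= c]. *)
Definition sqrt_gap (R : rcfType) (c lam : R) : R :=
  c ^+ 4 / (8 * (lam + c ^+ 2) * Num.sqrt lam).

(* The defect in Jensen's inequality: with [a = sqrt (M + t^2/p)] and [s = sqrt M],
   [a = s + (t^2/p)/(2 s) - (a - s)^2/(2 s)]. *)
Lemma sqrt_mix_gap (R : rcfType) (p t M c lam : R) : 0 < p -> p <= 1 - t -> 0 < c -> c <= t ->
  0 <= M -> M <= lam -> 0 <= M - t ^+ 2 / (1 - p) ->
  p * Num.sqrt (M + t ^+ 2 / p) + (1 - p) * Num.sqrt (M - t ^+ 2 / (1 - p))
    <= Num.sqrt M - sqrt_gap c lam.
Proof.
move=> p0 pt c0 ct M0 Mlam HM.
have t0 : 0 < t by lra.
have p1 : 0 < 1 - p by lra.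
have v0 : 0 < t ^+ 2 / (1 - p) by rewrite divr_gt0 // exprn_gt0.
have M1 : 0 < M by lra.
have lam0 : 0 < lam by lra.
set a := Num.sqrt _; set b := Num.sqrt (M - _); set s := Num.sqrt M.
have a0 : 0 <= a by apply: sqrtr_ge0.
have b0 : 0 <= b by apply: sqrtr_ge0.
have s0 : 0 < s by rewrite sqrtr_gt0.
have a2 : p * a ^+ 2 = p * M + t ^+ 2.
  rewrite /a sqr_sqrtr; last by rewrite addr_ge0 // divr_ge0 ?sqr_ge0 // ltW.
  by field; rewrite gt_eqF.
have b2 : (1 - p) * b ^+ 2 = (1 - p) * M - t ^+ 2.
  by rewrite /b sqr_sqrtr //; field; rewrite gt_eqF.
have s2 : s ^+ 2 = M by apply: sqr_sqrtr.
have as_ : s <= a by rewrite ler_wsqrtr // lerDl divr_ge0 ?sqr_ge0 ?ltW.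
have a_gt0 : 0 < a by lra.
have sl : s <= Num.sqrt lam by rewrite ler_wsqrtr.
have key : 2 * s * (s - (p * a + (1 - p) * b)) >= p * (a - s) ^+ 2.
  have : 0 <= (1 - p) * (b - s) ^+ 2 by rewrite mulr_ge0 ?sqr_ge0 ?ltW.
  have -> : (1 - p) * (b - s) ^+ 2 = (1 - p) * b ^+ 2 - 2 * s * (1 - p) * b + (1 - p) * s ^+ 2 by ring.
  have -> : p * (a - s) ^+ 2 = p * a ^+ 2 - 2 * s * p * a + p * s ^+ 2 by ring.
  rewrite a2 b2 s2.
  have -> : 2 * s * (s - (p * a + (1 - p) * b)) = 2 * s ^+ 2 - 2 * s * p * a - 2 * s * (1 - p) * b by ring.
  rewrite s2; lra.
(* [t ^+ 2 = p * (a - s) * (a + s)] is at most [2 * p * a * (a - s)] because [s <= a]; then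
   square. *)
have key2 : t ^+ 4 <= p * (a - s) ^+ 2 * (4 * (p * a ^+ 2)).
  have -> : p * (a - s) ^+ 2 * (4 * (p * a ^+ 2)) = (p * (a - s) * (2 * a)) ^+ 2 by ring.
  have -> : t ^+ 4 = (t ^+ 2) ^+ 2 by ring.
  rewrite ler_pXn2r ?nnegrE ?sqr_ge0 ?mulr_ge0 ?subr_ge0 //; try lra.
  have -> : t ^+ 2 = p * (a - s) * (a + s).
    have -> : p * (a - s) * (a + s) = p * a ^+ 2 - p * s ^+ 2 by ring.
    by rewrite a2 s2; ring.
  by rewrite ler_wpM2l ?mulr_ge0 ?subr_ge0 //; lra.
have L0 : 0 < lam + t ^+ 2 by rewrite addr_gt0 ?exprn_gt0.
have key3 : t ^+ 4 / (4 * (lam + t ^+ 2)) <= p * (a - s) ^+ 2.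
  rewrite ler_pdivrMr ?mulr_gt0 //; apply: (le_trans key2).
  apply: ler_wpM2l; first by rewrite mulr_ge0 ?sqr_ge0 // ltW.
  apply: ler_wpM2l => //; rewrite a2 lerD2r; apply: le_trans Mlam.
  by rewrite -[leRHS]mul1r; apply: ler_wpM2r => //; lra.
have Lc0 : 0 < lam + c ^+ 2 by rewrite addr_gt0 ?exprn_gt0.
(* [t ^+ 4 / (lam + t ^+ 2)] increases with [t], so [t] may be replaced by its lower bound [c]. *)
have key4 : c ^+ 4 / (4 * (lam + c ^+ 2)) <= t ^+ 4 / (4 * (lam + t ^+ 2)).
  rewrite ler_pdivrMr ?mulr_gt0 // mulrAC ler_pdivlMr ?mulr_gt0 //.
  have ct2 : c ^+ 2 <= t ^+ 2 by rewrite ler_pXn2r ?nnegrE // ltW.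
  have ct4 : c ^+ 4 <= t ^+ 4 by rewrite ler_pXn2r ?nnegrE // ltW.
  have -> : c ^+ 4 * (4 * (lam + t ^+ 2)) = 4 * lam * c ^+ 4 + 4 * (c ^+ 2 * t ^+ 2) * c ^+ 2 by ring.
  have -> : t ^+ 4 * (4 * (lam + c ^+ 2)) = 4 * lam * t ^+ 4 + 4 * (c ^+ 2 * t ^+ 2) * t ^+ 2 by ring.
  have lam0' := ltW lam0.
  have A1 : 0 <= 4 * lam by rewrite mulr_ge0.
  have A2 : 0 <= 4 * (c ^+ 2 * t ^+ 2) by rewrite mulr_ge0 // mulr_ge0 ?sqr_ge0.
  by apply: lerD; [apply: (ler_wpM2l A1)|apply: (ler_wpM2l A2)].
have K0 : 0 <= c ^+ 4 / (4 * (lam + c ^+ 2)).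
  by rewrite ltW // divr_gt0 ?exprn_gt0 ?mulr_gt0.
have sl0 : 0 < Num.sqrt lam by rewrite sqrtr_gt0.
rewrite lerBrDl -lerBrDr.
apply: (@le_trans _ _ (c ^+ 4 / (4 * (lam + c ^+ 2)) / (2 * s))).
  rewrite /sqrt_gap [leLHS](_ : _ = c ^+ 4 / (4 * (lam + c ^+ 2)) / (2 * Num.sqrt lam)); last first.
    by field; rewrite !gt_eqF.
  by rewrite ler_wpM2l // lef_pV2 ?posrE ?mulr_gt0 // ler_wpM2l.
by rewrite ler_pdivrMr ?mulr_gt0 // mulrC; lra.
Qed.

(** * The exploration and its supermartingale *)

Section Explore.
Variables (R : rcfType) (T : finType) (e : rel T) (beta : T -> nat) (q : nat).
Hypotheses (e_sym : symmetric e) (e_irr : irreflexive e).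
Local Notation gdeg := (gdeg e).
Local Notation lap_det := (lap_det R e).
Local Notation allowed := (@allowed T e q).
Local Notation valid := (valid e beta q).
Local Notation live := (live R e beta).
Local Notation harm := (harm e beta).
Local Notation cond := (cond e beta).

Lemma card_allowed_valid U D h0 : valid U D -> #|allowed U D h0|%:R = lap_det U D.
Proof.
move=> V; apply: card_allowed => // z /V /andP[H ->]; rewrite andbT.
by rewrite (leq_trans _ H) ?leq_addr.
Qed.

(* Given the past, the edge makes [y] topple with probability [p], and the
   conductance is a martingale: it moves by [h y ^+ 2 / p] or [- h y ^+ 2 / (1 - p)]. *)
Lemma explore_edge U D y (h : T -> R) : valid U D -> y \in U -> 0 < live U D y ->
  lap_det U D != 0 -> harm U D h ->
  exists2 p : R, 0 < p <= 1 - h y &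
  [/\ valid U (decr D y) /\ valid (U :\ y) D,
      lap_det U (decr D y) = (1 - p) * lap_det U D /\
      lap_det (U :\ y) D = p * lap_det U D,
      p != 1 -> exists2 h', harm U (decr D y) h' &
        cond U (decr D y) h' = cond U D h - h y ^+ 2 / (1 - p),
      exists2 h', harm (U :\ y) D h' &
        cond (U :\ y) D h' = cond U D h + h y ^+ 2 / p &
      exists v : 'I_q, forall h0 (E : {set {ffun T -> 'I_q}}), #|allowed U D h0 :&: E| =
    (#|allowed U (decr D y) h0 :&: E| + #|allowed (U :\ y) D (upd h0 y v) :&: E|)%N].
Proof.
move=> V yU ly nz H; have [g [g0 gL gE]] := lap_green yU nz.
have /andP[Vy1 Vy2] := V y yU.
have Dlt : (gdeg U y + beta y < D y)%N.
  by move: ly; rewrite /live -addrA -opprD -natrD subr_gt0 ltr_nat.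
have Dy0 : (0 < D y)%N by apply: leq_ltn_trans Dlt.
have gge z : z \in U -> 0 <= g z.
  by move=> zU; apply: (lapU_min e_sym V nz _ zU) => w wU; rewrite gL // ler0n.
have gy0 : 0 < g y.
  have := gL y yU; rewrite eqxx /lapU => E.
  have S0 : 0 <= \sum_(w in U) (e y w)%:R * g w.
    by apply: sumr_ge0 => w wU; rewrite mulr_ge0 ?gge.
  rewrite -(pmulr_rgt0 _ (_ : 0 < (D y)%:R)) ?ltr0n //.
  by move: E S0; set S := \sum_(w in U) _ => /=; rewrite mulr1n => E S0; lra.
(* A positive [live] is an integer, so the term at [y] in [sum_live_green] is at least [g y]; this
   gives [g y <= 1 - h y]. *)
have live1 : 1 <= live U D y.
  rewrite /live -addrA -opprD -natrD lerBrDr -[1]/(1%:R) -natrD ler_nat.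
  by rewrite add1n.
have gy1 : g y <= 1 - h y.
  rewrite -(sum_live_green e_sym yU gL H) (bigD1 y) //=.
  have : 0 <= \sum_(i in U | i != y) live U D i * g i.
    by apply: sumr_ge0 => w /andP[wU _]; rewrite mulr_ge0 ?gge ?(live_ge0 _ V).
  have : 1 * g y <= live U D y * g y by rewrite ler_pM2r.
  lra.
exists (g y); first by rewrite gy0 gy1.
split.
- split=> z.
    move=> zU; have /andP[H1 H2] := V z zU; rewrite /decr; case: eqVneq => [->|_].
      by rewrite -ltnS prednK // Dlt (leq_trans (leq_pred _)).
    by rewrite H1.
  rewrite inE => /andP[_ zU]; have /andP[H1 ->] := V z zU.
  by rewrite (leq_trans _ H1) // leq_add2r gdegS // subD1set.
- split=> //; have := lap_det_decr R e_irr yU Dy0; rewrite gE => E.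
  by rewrite mulrBl mul1r {1}E addrK.
- by move=> p1; apply: harm_closed.
- by apply: harm_open => //; rewrite gt_eqF.
- have vq : ((D y).-1 < q)%N by rewrite prednK.
  exists (Ordinal vq) => h0 E; apply: card_allowed_split => //=; first by rewrite prednK.
  by rewrite -ltnS prednK // (leq_ltn_trans _ Dlt) ?leq_addr.
Qed.

Variables (lev : T -> nat) (x : T) (N : nat).
Hypotheses (deg_q : forall z, (gdeg setT z + beta z = q)%N)
  (lev_lip : forall z w, e z w -> (lev z <= (lev w).+1)%N).

(* The sites that topple in a wave form the least such [C]. *)
Definition far : {set {ffun T -> 'I_q}} := [set h : {ffun T -> 'I_q} |
  [forall C : {set T}, (x \in C) && [forall y, (y \notin C) ==> (h y + gdeg C y < q)%N]
     ==> [exists z in C, (N < lev z)%N]]].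

Lemma farP (h : {ffun T -> 'I_q}) : reflect (forall C : {set T}, x \in C ->
   (forall y, y \notin C -> (h y + gdeg C y < q)%N) -> exists2 z, z \in C & (N < lev z)%N)
  (h \in far).
Proof.
rewrite inE; apply: (iffP forallP) => [H C xC HC|H C].
  apply/exists_inP; have := H C; rewrite xC /= => /implyP; apply.
  by apply/forallP => y; apply/implyP => /HC.
apply/implyP => /andP[xC /forallP HC]; apply/exists_inP/H => // y.
exact/implyP.
Qed.

Lemma gdeg_split U z : (gdeg setT z = gdeg U z + gdeg (~: U) z)%N.
Proof.
rewrite /gdeg (bigID (mem U)) /=; congr (_ + _)%N; apply: eq_bigl => w; rewrite !inE //.
Qed.

Variables (lam kap c0 : R).
Hypotheses (lam0 : 0 < lam) (kap0 : 0 < kap) (c00 : 0 < c0) (N0 : (0 < N)%N)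
  (kapE : 2 * kap <= sqrt_gap c0 lam).
(** The geometric input, supplied for boxes by [level_escape]: when a new level is reached at [y], a
    live edge leads to a site [y'] of voltage at least [c0], unless the conductance exceeds
    [lam]. *)
Hypothesis escape : forall U D l y, valid U D -> y \in U ->
  (forall k, k \notin U -> (lev k <= l)%N) -> lev y = l.+1 -> (l.+1 <= N)%N ->
  exists2 y', y' \in U :\ y & [/\ 0 < live (U :\ y) D y', (lev y' <= l.+2)%N &
    forall h, lap_det (U :\ y) D != 0 -> harm (U :\ y) D h ->
      cond (U :\ y) D h <= lam -> c0 <= h y'].

(* A supermartingale of the exploration as long as [M <= lam]: the expected drop of
   [sqrt M] at each new level pays for the term [kap * l]. *)
Definition potential M (l : nat) : R :=
  M / lam + (Num.sqrt M + kap * l%:R) / (kap * N%:R).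

Lemma potential_ge1 M l : 0 <= M -> (lam <= M) || (N <= l)%N -> 1 <= potential M l.
Proof.
move=> M0 H; have n0 : 0 < kap * N%:R by rewrite mulr_gt0 ?ltr0n.
have A : 0 <= (Num.sqrt M + kap * l%:R) / (kap * N%:R).
  by rewrite divr_ge0 ?(ltW n0) // addr_ge0 ?sqrtr_ge0 // mulr_ge0 // ltW.
have B : 0 <= M / lam by rewrite divr_ge0 // ltW.
rewrite /potential; case/orP: H => H.
  by rewrite -[leLHS]addr0; apply: lerD; rewrite // ler_pdivlMr ?mul1r.
rewrite -[leLHS]add0r; apply: lerD => //; rewrite ler_pdivlMr // mul1r.
by rewrite -[leLHS]add0r; apply: lerD; rewrite ?sqrtr_ge0 // ler_pM2l // ler_nat.
Qed.

Lemma potential_ge0 M l : 0 <= M -> 0 <= potential M l.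
Proof.
move=> M0; have n0 : 0 < kap * N%:R by rewrite mulr_gt0 ?ltr0n.
rewrite addr_ge0 ?divr_ge0 ?(ltW n0) ?(ltW lam0) //.
by rewrite addr_ge0 ?sqrtr_ge0 // mulr_ge0 // ltW.
Qed.

Lemma potential_mix (p t M : R) l : 0 < p -> p <= 1 - t -> 0 <= t -> 0 <= M ->
  (p != 1 -> 0 <= M - t ^+ 2 / (1 - p)) ->
  p * potential (M + t ^+ 2 / p) l + (1 - p) * potential (M - t ^+ 2 / (1 - p)) l
    <= potential M l.
Proof.
move=> p0 pt t0 M0 HM; have n0 : 0 < kap * N%:R by rewrite mulr_gt0 ?ltr0n.
have := sqrt_mix p0 pt t0 M0 HM; rewrite -(ler_pM2r (_ : 0 < (kap * N%:R)^-1)) ?invr_gt0 //.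
rewrite /potential; set A := Num.sqrt _; set B := Num.sqrt (_ - _); set S := Num.sqrt _.
set k := (kap * N%:R)^-1 => H.
have [p1|p1] := eqVneq p 1.
  have t00 : t = 0 by lra.
  move: H; rewrite p1 t00 expr0n /= !mul0r subrr !mul0r !addr0 !mul1r => H; lra.
have E : p * (M + t ^+ 2 / p) + (1 - p) * (M - t ^+ 2 / (1 - p)) = M.
  by field; rewrite subr_eq0 eq_sym p1 gt_eqF.
rewrite -[in leRHS]E; rewrite -subr_ge0 in H; rewrite -subr_ge0.
by apply: le_trans H _; rewrite le_eqVlt; apply/orP; left; apply/eqP; ring.
Qed.

(** The level index grows by 2 or by 1, at an expected cost [kap * (1 + p) <= 2 * kap], which the
    gap in Jensen's inequality covers. *)
Lemma potential_mix_gap (p t M : R) l : 0 < p -> p <= 1 - t -> c0 <= t -> 0 <= M -> M <= lam ->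
  0 <= M - t ^+ 2 / (1 - p) ->
  p * potential (M + t ^+ 2 / p) l.+2 + (1 - p) * potential (M - t ^+ 2 / (1 - p)) l.+1
    <= potential M l.
Proof.
move=> p0 pt ct M0 Ml HM; have n0 : 0 < kap * N%:R by rewrite mulr_gt0 ?ltr0n.
have k0 : 0 < (kap * N%:R)^-1 by rewrite invr_gt0.
have := sqrt_mix_gap p0 pt c00 ct M0 Ml HM.
rewrite /potential; set A := Num.sqrt _; set B := Num.sqrt (_ - _); set S := Num.sqrt _.
move: k0; set k := (kap * N%:R)^-1 => k0 H.
have E : p * (M + t ^+ 2 / p) + (1 - p) * (M - t ^+ 2 / (1 - p)) = M.
  by field; rewrite !gt_eqF //; move: c00; lra.
have H2 : p * (A + kap * l.+2%:R) + (1 - p) * (B + kap * l.+1%:R) <= S + kap * l%:R.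
  have -> : l.+2%:R = l%:R + 2 :> R by rewrite -addn2 natrD.
  have -> : l.+1%:R = l%:R + 1 :> R by rewrite -addn1 natrD.
  have -> : p * (A + kap * (l%:R + 2)) + (1 - p) * (B + kap * (l%:R + 1)) =
    (p * A + (1 - p) * B) + kap * l%:R + kap + kap * p by ring.
  have : kap * p <= kap * 1 by rewrite ler_pM2l //; move: c00; lra.
  move: kapE; lra.
rewrite -(ler_pM2r k0) in H2; rewrite -[in leRHS]E.
rewrite -subr_ge0 in H2; rewrite -subr_ge0.
by apply: le_trans H2 _; rewrite le_eqVlt; apply/orP; left; apply/eqP; ring.
Qed.

(** The stopping rule: when the conductance has reached [lam] or the level [N], bounding by the
    total count is enough. *)
Lemma card_far_trivial U D h0 M l : valid U D -> 1 <= potential M l ->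
  #|allowed U D h0 :&: far|%:R <= lap_det U D * potential M l.
Proof.
move=> V F1; rewrite -(card_allowed_valid h0 V).
apply: (@le_trans _ _ #|allowed U D h0|%:R).
  by rewrite ler_nat subset_leq_card // subsetIl.
by rewrite -[leLHS]mulr1 ler_wpM2l.
Qed.

(** Strong induction on the total of [D], which drops with every revealed edge. If the edge to [y]
    makes it topple and opens a new level, the edge to [y'] is revealed at once, and its gap in
    Jensen's inequality pays for the level. *)
Lemma card_far_le U D l h0 h : valid U D -> x \notin U ->
  (forall k, k \notin U -> (lev k <= l)%N) -> lap_det U D != 0 -> harm U D h ->
  #|allowed U D h0 :&: far|%:R <= lap_det U D * potential (cond U D h) l.
Proof.
have [m] := ubnP (\sum_(z in U) D z)%N.
elim: m U D l h0 h => // m IH U D l h0 h; rewrite ltnS => leU V xU Hl nz H.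
have M0 := cond_ge0 e_sym V nz H.
have Zge U' D' : valid U' D' -> 0 <= lap_det U' D'.
  by move=> V'; rewrite -(card_allowed_valid (h0) V').
have [Nl|lN] := leqP N l; first by apply: card_far_trivial; rewrite ?potential_ge1 ?Nl ?orbT.
have [/exists_inP[y yU ly]|/exists_inPn noy] := boolP [exists y in U, 0 < live U D y]; last first.
  (* Without live edges the exploration has ended: [~: U] is a set as in [far] whose levels are all
     below [N], so no configuration is left. *)
  rewrite (_ : _ :&: _ = set0) ?cards0.
    by rewrite mulr_ge0 ?Zge // potential_ge0.
  apply/setP => f; rewrite in_set0 in_setI; apply/negbTE/negP => /andP[/allowedP[_ H2 _]].
  case/farP/(_ (~: U)) => [|z|z]; rewrite ?inE // ?negbK.
    move=> zU; have fD := H2 z zU; have /andP[Vz1 Vz2] := V z zU.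
    have : (D z <= gdeg U z + beta z)%N.
      by have := noy z zU; rewrite /live -addrA -opprD -natrD subr_gt0 ltr_nat -leqNgt.
    by have := gdeg_split U z; have := deg_q z; lia.
  by move=> /Hl zl; rewrite ltnNge (leq_trans zl) // ltnW.
have [p /andP[p0 pt] [[Vc Vo] [Zc Zo] Hc [ho Ho Mo] [v cardE]]] := explore_edge V yU ly nz H.
have h0y := harm_ge0 e_sym V nz H y.
have Dy0 : (0 < D y)%N.
  by rewrite -(ltr0n R); move: ly; rewrite /live; have := ler0n R (gdeg U y);
     have := ler0n R (beta y); lra.
have Z0 : 0 < lap_det U D by rewrite lt_def nz Zge.
have nzo : lap_det (U :\ y) D != 0 by rewrite Zo mulf_neq0 // gt_eqF.
have wo : (\sum_(z in U :\ y) D z < m)%N by apply: leq_trans (weight_setD1 yU Dy0) leU.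
have wc : (\sum_(z in U) decr D y z < m)%N by rewrite weight_decr.
have nzc : p != 1 -> lap_det U (decr D y) != 0.
  by move=> p1; rewrite Zc mulf_neq0 // subr_eq0 eq_sym.
have McP : p != 1 -> 0 <= cond U D h - h y ^+ 2 / (1 - p).
  move=> p1; have [hc Hhc <-] := Hc p1; exact: (cond_ge0 e_sym Vc (nzc p1) Hhc).
have boundc : #|allowed U (decr D y) h0 :&: far|%:R <=
    (1 - p) * lap_det U D * potential (cond U D h - h y ^+ 2 / (1 - p)) l.
  have [p1|p1] := eqVneq p 1.
    rewrite p1 subrr !mul0r.
    apply: (@le_trans _ _ #|allowed U (decr D y) h0|%:R).
      by rewrite ler_nat subset_leq_card // subsetIl.
    by rewrite card_allowed_valid // Zc p1 subrr mul0r.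
  have [hc Hhc <-] := Hc p1; rewrite -Zc; apply: IH => //; exact: nzc.
suff boundo : #|allowed (U :\ y) D (upd h0 y v) :&: far|%:R <=
    p * lap_det U D * potential (cond U D h + h y ^+ 2 / p) l.
  rewrite cardE natrD; apply: (le_trans (lerD boundc boundo)).
  rewrite [leLHS](_ : _ = lap_det U D * (p * potential (cond U D h + h y ^+ 2 / p) l +
     (1 - p) * potential (cond U D h - h y ^+ 2 / (1 - p)) l)); last by ring.
  by rewrite ler_pM2l // potential_mix.
have xUo : x \notin U :\ y by rewrite !inE negb_and xU orbT.
rewrite -Zo -Mo.
have [ly1|ly1] := leqP (lev y) l.
  apply: IH => // k; rewrite !inE negb_and negbK => /orP[/eqP->//|]; exact: Hl.
have lyE : lev y = l.+1.
  apply/eqP; rewrite eqn_leq ly1 andbT.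
  (* A live edge at [y] ends in the explored set, so the level can rise by one only. *)
  have [k kU eyk] : exists2 k, k \notin U & e y k.
    have [/existsP[k /andP[]]|/existsPn nok] := boolP [exists k, (k \notin U) && e y k].
      by exists k.
    move: ly; rewrite /live.
    have : gdeg (~: U) y = 0%N.
      by rewrite /gdeg big1 // => w; rewrite inE => wU; have := nok w; rewrite wU /=; case: (e y w).
    have := deg_q y; rewrite (gdeg_split U) => + E; rewrite E addn0 => E2.
    have /andP[_] := V y yU; rewrite -E2 -(ler_nat R) natrD; lra.
  by apply: leq_trans (lev_lip eyk) _; rewrite ltnS Hl.
have M1 := cond_ge0 e_sym Vo nzo Ho.
have [Ml|Ml] := leP lam (cond (U :\ y) D ho).
  by apply: card_far_trivial; rewrite ?potential_ge1 ?Ml.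
have HUo k : k \notin U :\ y -> k = y \/ (lev k <= l)%N.
  by rewrite !inE negb_and negbK => /orP[/eqP|/Hl]; [left|right].
have [y' y'U [ly' levy' esc]] := escape V yU Hl lyE lN.
have {}esc := esc ho nzo Ho (ltW Ml).
have [p' /andP[p'0 p't] [[Vc' Vo'] [Zc' Zo'] Hc' [ho' Ho' Mo'] [v' cardE']]] :=
  explore_edge Vo y'U ly' nzo Ho.
have D'y0 : (0 < D y')%N.
  by rewrite -(ltr0n R); move: ly'; rewrite /live; have := ler0n R (gdeg (U :\ y) y');
     have := ler0n R (beta y'); lra.
have p'1 : p' != 1 by rewrite lt_eqF //; move: c00; lra.
have [hc' Hhc' Mc'] := Hc' p'1.
have Z1 : 0 < lap_det (U :\ y) D by rewrite lt_def nzo Zge.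
have nzc' : lap_det (U :\ y) (decr D y') != 0 by rewrite Zc' mulf_neq0 // subr_eq0 eq_sym.
have nzo' : lap_det (U :\ y :\ y') D != 0 by rewrite Zo' mulf_neq0 // gt_eqF.
have bc' : #|allowed (U :\ y) (decr D y') (upd h0 y v) :&: far|%:R <=
   (1 - p') * lap_det (U :\ y) D * potential (cond (U :\ y) D ho - ho y' ^+ 2 / (1 - p')) l.+1.
  rewrite -Zc' -Mc'; apply: IH => //.
    by apply: leq_trans wo; rewrite -(weight_decr y'U D'y0); apply: leqW.
  by move=> k /HUo[->|/leqW //]; rewrite lyE.
have bo' : #|allowed (U :\ y :\ y') D (upd (upd h0 y v) y' v') :&: far|%:R <=
   p' * lap_det (U :\ y) D * potential (cond (U :\ y) D ho + ho y' ^+ 2 / p') l.+2.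
  rewrite -Zo' -Mo'; apply: IH => //.
  - by apply: leq_trans (weight_setD1 y'U D'y0) _; apply: ltnW.
  - by rewrite in_setD1 negb_and xUo orbT.
  - move=> k; rewrite in_setD1 negb_and negbK => /orP[/eqP->//|/HUo[->|kl]].
      by rewrite lyE.
    by rewrite (leq_trans kl) // leqW.
rewrite cardE' natrD; apply: (le_trans (lerD bc' bo')).
rewrite [leLHS](_ : _ = lap_det (U :\ y) D *
  (p' * potential (cond (U :\ y) D ho + ho y' ^+ 2 / p') l.+2 +
     (1 - p') * potential (cond (U :\ y) D ho - ho y' ^+ 2 / (1 - p')) l.+1)); last by ring.
rewrite ler_pM2l //; apply: potential_mix_gap => //; first exact: ltW.
by rewrite -Mc'; exact: (cond_ge0 e_sym Vc' nzc' Hhc').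
Qed.

End Explore.

(** * Polya's urn flow *)

Section UrnFlow.
Variables (R : realFieldType) (K : nat).
Implicit Types phi : nat -> nat -> nat -> R.

Definition layer (n : nat) phi : R :=
  \sum_(i < K) \sum_(j < K) \sum_(k < K) (i + j + k == n)%N%:R * phi i j k.

(* A layer of the octant has [(n + 1)(n + 2) / 2] points, and the urn sits at time [n]
   at a uniform point of its layer; it moves from [(i, j, k)] along the three axes
   with probabilities [(i + 1) / (n + 3)], [(j + 1) / (n + 3)], [(k + 1) / (n + 3)]. *)
Definition urn_wt (n : nat) : R := 2 / (n.+1%:R * n.+2%:R).

Definition urn_avg n phi : R := urn_wt n * layer n phi.

Definition grad2 phi i j k : R := (phi i.+1 j k - phi i j k) ^+ 2 +
  (phi i j.+1 k - phi i j k) ^+ 2 + (phi i j k.+1 - phi i j k) ^+ 2.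

Lemma sum_shift (f : nat -> R) : f 0%N = 0 -> f K = 0 ->
  \sum_(i < K) f i.+1 = \sum_(i < K) f i.
Proof.
move=> f0 fK; apply: (addrI (f 0%N)).
by rewrite -[LHS](big_ord_recl K (fun i => f i)) big_ord_recr /= fK f0 addr0 add0r.
Qed.

Lemma layerD n phi psi :
  layer n (fun i j k => phi i j k + psi i j k) = layer n phi + layer n psi.
Proof.
rewrite -big_split; apply: eq_bigr => i _; rewrite -big_split; apply: eq_bigr => j _.
by rewrite -big_split; apply: eq_bigr => k _; rewrite mulrDr.
Qed.

Lemma layerZ n (c : R) phi : layer n (fun i j k => c * phi i j k) = c * layer n phi.
Proof.
rewrite mulr_sumr; apply: eq_bigr => i _; rewrite mulr_sumr; apply: eq_bigr => j _.
by rewrite mulr_sumr; apply: eq_bigr => k _; rewrite mulrCA.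
Qed.

Lemma layer_le n phi psi : (forall i j k, (i + j + k)%N = n -> phi i j k <= psi i j k) ->
  layer n phi <= layer n psi.
Proof.
move=> H; apply: ler_sum => i _; apply: ler_sum => j _; apply: ler_sum => k _.
by case: eqP => [/H|]; rewrite ?mul1r ?mul0r.
Qed.

Lemma eq_layer n phi psi : (forall i j k, (i + j + k)%N = n -> phi i j k = psi i j k) ->
  layer n phi = layer n psi.
Proof. by move=> H; apply/eqP; rewrite eq_le !layer_le // => i j k /H ->. Qed.

(** After shifting indices, a point of layer [n + 1] collects the weights [i], [j], [k] from its
    predecessors, in total [n + 1]; hence the urn stays uniform on layers. The bound on [n] makes
    the truncation at [K] invisible. *)
Lemma layer_step n phi : (n.+1 < K)%N ->
  layer n (fun i j k => i.+1%:R * phi i.+1 j k + j.+1%:R * phi i j.+1 k + k.+1%:R * phi i j k.+1)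
  = n.+1%:R * layer n.+1 phi.
Proof.
move=> nK; rewrite -layerZ.
rewrite (@eq_layer n.+1 _ (fun i j k => i%:R * phi i j k + j%:R * phi i j k + k%:R * phi i j k));
  last first.
  by move=> i j k <-; rewrite !natrD; ring.
rewrite !layerD; congr (_ + _ + _).
- rewrite /layer exchange_big [RHS]exchange_big; apply: eq_bigr => j _ /=.
  rewrite exchange_big [RHS]exchange_big; apply: eq_bigr => k _ /=.
  rewrite -(@sum_shift (fun i => (i + j + k == n.+1)%N%:R * (i%:R * phi i j k))) ?mul0r ?mulr0 //.
    by rewrite (_ : (_ == _) = false) ?mul0r //; apply/negbTE; lia.
- apply: eq_bigr => i _; rewrite exchange_big [RHS]exchange_big; apply: eq_bigr => k _ /=.
  rewrite -(@sum_shift (fun j => (i + j + k == n.+1)%N%:R * (j%:R * phi i j k))) ?mul0r ?mulr0 //.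
    by apply: eq_bigr => j _; rewrite addnS addSn.
  by rewrite (_ : (_ == _) = false) ?mul0r //; apply/negbTE; lia.
- apply: eq_bigr => i _; apply: eq_bigr => j _ /=.
  rewrite -(@sum_shift (fun k => (i + j + k == n.+1)%N%:R * (k%:R * phi i j k))) ?mul0r ?mulr0 //.
    by apply: eq_bigr => k _; rewrite addnS.
  by rewrite (_ : (_ == _) = false) ?mul0r //; apply/negbTE; lia.
Qed.

Lemma urn_avg_step n phi : (n.+1 < K)%N -> urn_avg n.+1 phi =
  layer n (fun i j k => urn_wt n / n.+3%:R *
    (i.+1%:R * phi i.+1 j k + j.+1%:R * phi i j.+1 k + k.+1%:R * phi i j k.+1)).
Proof.
move=> nK; rewrite layerZ layer_step // /urn_avg /urn_wt.
have n0 := ler0n R n; field; rewrite !gt_eqF //; lra.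
Qed.

Lemma urn_avg1 n : (n < K)%N -> urn_avg n (fun _ _ _ => 1) = 1.
Proof.
elim: n => [|n IH] nK.
  rewrite /urn_avg /layer; case: K nK => // K' _.
  rewrite big_ord_recl [X in _ * (_ + X)]big1 ?addr0 => [|i _]; last first.
    by rewrite big1 // => j _; rewrite big1 // => k _; rewrite mul0r.
  rewrite big_ord_recl [X in _ * (_ + X)]big1 ?addr0 => [|i _]; last first.
    by rewrite big1 // => j _; rewrite mul0r.
  rewrite big_ord_recl [X in _ * (_ + X)]big1 ?addr0 => [|i _]; last by rewrite mul0r.
  by rewrite eqxx !mul1r /urn_wt mul1r mulr1 divff // pnatr_eq0.
rewrite urn_avg_step // -[RHS](IH (ltnW nK)) /urn_avg -layerZ; apply: eq_layer => i j k E.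
have -> : n.+3%:R = i.+1%:R + j.+1%:R + k.+1%:R :> R by rewrite -!natrD; congr _%:R; lia.
by rewrite !mulr1 divfK ?mulr1 // -!natrD pnatr_eq0; lia.
Qed.

(** AM-GM splits each increment between the energy of the flow and that of [phi]. The jump
    probabilities have squares summing to at most 1, so the flow has energy at most [urn_wt n] on
    layer [n]; [tau] is fixed in [urn_escape]. *)
Lemma urn_avg_incr n phi (tau : R) : (n.+1 < K)%N -> 0 < tau ->
  urn_avg n.+1 phi <= urn_avg n phi + urn_wt n / (2 * tau) + tau / 2 * layer n (grad2 phi).
Proof.
move=> nK t0.
(* The layer has [1 / urn_wt n] points; this term is spread over them so that the inequality can be
   checked point by point. *)
have {1}-> : urn_wt n / (2 * tau) = layer n (fun _ _ _ => urn_wt n ^+ 2 / (2 * tau)).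
  have := urn_avg1 (ltnW nK); rewrite /urn_avg => E.
  transitivity (urn_wt n * (urn_wt n * layer n (fun _ _ _ => 1)) / (2 * tau)).
    by rewrite E mulr1.
  transitivity (urn_wt n ^+ 2 / (2 * tau) * layer n (fun _ _ _ => 1)); first by ring.
  by rewrite -layerZ; apply: eq_layer => i j k _; rewrite mulr1.
rewrite urn_avg_step // /urn_avg -!layerZ -!layerD; apply: layer_le => i j k E.
set w := urn_wt n.
have nE : n.+3%:R = i.+1%:R + j.+1%:R + k.+1%:R :> R by rewrite -!natrD; congr _%:R; lia.
have i0 : 0 < i.+1%:R :> R by rewrite ltr0n.
have j0 : 0 < j.+1%:R :> R by rewrite ltr0n.
have k0 : 0 < k.+1%:R :> R by rewrite ltr0n.
set a := i.+1%:R / n.+3%:R : R; set b := j.+1%:R / n.+3%:R : R; set c := k.+1%:R / n.+3%:R : R.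
have n0 : 0 < n.+3%:R :> R by rewrite ltr0n.
have a0 : 0 <= a by rewrite divr_ge0 // ltW.
have b0 : 0 <= b by rewrite divr_ge0 // ltW.
have c0 : 0 <= c by rewrite divr_ge0 // ltW.
have abc : a + b + c = 1 by rewrite /a /b /c -!mulrDl -nE divff // gt_eqF.
(* The linearized Cauchy-Schwarz inequality between the energies of the flow and of [phi]. *)
have amgm (s d : R) : w * s * d <= w ^+ 2 / (2 * tau) * s ^+ 2 + tau / 2 * d ^+ 2.
  have : 0 <= (w * s - tau * d) ^+ 2 / (2 * tau) by rewrite divr_ge0 ?sqr_ge0 // mulr_ge0 // ltW.
  have -> : (w * s - tau * d) ^+ 2 / (2 * tau) =
     w ^+ 2 / (2 * tau) * s ^+ 2 + tau / 2 * d ^+ 2 - w * s * d.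
    by field; rewrite gt_eqF.
  lra.
have W0 : 0 <= w ^+ 2 / (2 * tau) by rewrite divr_ge0 ?sqr_ge0 // mulr_ge0 // ltW.
have sq1 : w ^+ 2 / (2 * tau) * (a ^+ 2 + b ^+ 2 + c ^+ 2) <= w ^+ 2 / (2 * tau) * 1.
  apply: ler_wpM2l => //; have : 0 <= a * b + b * c + c * a by apply: addr_ge0; [apply: addr_ge0|]; apply: mulr_ge0.
  have -> : a ^+ 2 + b ^+ 2 + c ^+ 2 = (a + b + c) ^+ 2 - 2 * (a * b + b * c + c * a) by ring.
  rewrite abc expr1n; lra.
have A := amgm a (phi i.+1 j k - phi i j k).
have B := amgm b (phi i j.+1 k - phi i j k).
have C := amgm c (phi i j k.+1 - phi i j k).
have -> : w / n.+3%:R * (i.+1%:R * phi i.+1 j k + j.+1%:R * phi i j.+1 k + k.+1%:R * phi i j k.+1)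
  = w * phi i j k * (a + b + c) + (w * a * (phi i.+1 j k - phi i j k) +
  w * b * (phi i j.+1 k - phi i j k) + w * c * (phi i j k.+1 - phi i j k)).
  by rewrite /a /b /c; ring.
rewrite abc mulr1 /grad2; lra.
Qed.

(** [urn_wt n] is twice the difference of [1 / (n + 1)] and [1 / (n + 2)], so the energy of the flow
    telescopes and is finite. *)
Lemma urn_flow phi (tau : R) r m : (r <= m)%N -> (m < K)%N -> 0 < tau ->
  urn_avg m phi - urn_avg r phi <= tau^-1 * (r.+1%:R^-1 - m.+1%:R^-1) +
    tau / 2 * \sum_(r <= n < m) layer n (grad2 phi).
Proof.
move=> rm + t0; elim: m rm => [|m IH].
  by rewrite leqn0 => /eqP -> _; rewrite big_geq // !subrr !mulr0 addr0.
rewrite leq_eqVlt => /orP[/eqP -> _|]; first by rewrite big_geq // !subrr !mulr0 addr0.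
rewrite ltnS => rm mK; have {}IH := IH rm (ltnW mK).
have := urn_avg_incr phi mK t0; rewrite big_nat_recr //=.
have -> : urn_wt m / (2 * tau) = tau^-1 * (m.+1%:R^-1 - m.+2%:R^-1).
  rewrite /urn_wt -[m.+2%:R]natr1; have m0 := ler0n R m; field.
  by rewrite !gt_eqF //; lra.
move: IH; move: (r.+1%:R^-1) (m.+1%:R^-1) (m.+2%:R^-1) => a b c.
rewrite !mulrBr !mulrDr; lra.
Qed.

Lemma sum_layer (L r : nat) phi : (forall i j k, 0 <= phi i j k) ->
  \sum_(r <= n < L) layer n phi <= \sum_(i < K) \sum_(j < K) \sum_(k < K) phi i j k.
Proof.
move=> P; rewrite /layer exchange_big; apply: ler_sum => i _ /=.
rewrite exchange_big; apply: ler_sum => j _ /=.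
rewrite exchange_big; apply: ler_sum => k _ /=.
rewrite -mulr_suml -[leRHS]mul1r; apply: ler_wpM2r => //; rewrite -natr_sum lern1.
rewrite (eq_bigr (fun n => if pred1 (i + j + k)%N n then 1%N else 0%N)) => [|n _]; last first.
  by rewrite eq_sym /=; case: eqP.
by rewrite -big_mkcond sum1_count count_uniq_mem ?iota_uniq ?leq_b1.
Qed.

(** If [phi] were below 1/2 on all of layer [r], its average would rise by at least 1/2 up to layer
    [L], whereas the energy bound allows only 3/8. *)
Lemma urn_escape (M lam : R) phi r L : 0 < lam -> M <= lam -> 32 * lam <= r.+1%:R ->
  (L < K)%N -> (forall i j k, (L <= i + j + k)%N -> phi i j k = 1) ->
  \sum_(i < K) \sum_(j < K) \sum_(k < K) grad2 phi i j k <= 2 * M ->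
  exists i j k, (i + j + k)%N = r /\ 2^-1 <= phi i j k.
Proof.
move=> lam0 Ml Hr LK phi1 HE.
have [Lr|rL] := leqP L r.
  exists r, 0%N, 0%N; rewrite !addn0; split => //; rewrite phi1 ?addn0 //.
  by rewrite invf_le1 ?ler1n.
apply: contrapT => noijk.
have avg_r : urn_avg r phi <= 2^-1.
  have := urn_avg1 (ltn_trans rL LK); rewrite /urn_avg => E1.
  rewrite -[leRHS]mulr1 -[X in _ <= _ * X]E1 mulrCA -[X in _ <= _ * X]layerZ.
  apply: ler_wpM2l; first by rewrite divr_ge0 ?mulr_ge0.
  apply: layer_le => i j k E; rewrite mulr1 leNgt; apply/negP => /ltW H.
  by apply: noijk; exists i, j, k.
have avg_L : urn_avg L phi = 1.
  rewrite -[RHS](urn_avg1 LK) /urn_avg; congr (_ * _); apply: eq_layer => i j k E.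
  by rewrite phi1 ?E.
(* With [tau = 1 / (4 * lam)] the two terms of [urn_flow] are at most 1/8 and 1/4. *)
have t0 : 0 < (4 * lam)^-1 by rewrite invr_gt0 mulr_gt0.
have := urn_flow phi (ltnW rL) LK t0; rewrite avg_L invrK.
have S : \sum_(r <= n < L) layer n (grad2 phi) <= 2 * lam.
  apply: (@le_trans _ _ (2 * M)); last by rewrite ler_pM2l.
  apply: le_trans HE; apply: sum_layer => i j k.
  by rewrite /grad2 !addr_ge0 ?sqr_ge0.
have S2 : (4 * lam)^-1 / 2 * \sum_(r <= n < L) layer n (grad2 phi) <= 4^-1.
  rewrite -ler_pdivlMl ?divr_gt0 //; apply: (le_trans S).
  by rewrite le_eqVlt; apply/orP; left; apply/eqP; field; rewrite gt_eqF.
have r1 : 4 * lam / r.+1%:R <= 8^-1 by rewrite ler_pdivrMr ?ltr0n //; lra.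
have L1 : 0 <= 4 * lam / L.+1%:R by rewrite divr_ge0 // mulr_ge0 // ltW.
move: r1 L1; move: (r.+1%:R^-1) (L.+1%:R^-1) => a b.
rewrite mulrBr; lra.
Qed.

End UrnFlow.

From mathcomp Require Import finmap.
From mathcomp Require Import boolp classical_sets functions cardinality reals ereal
  topology normedtype sequences measure probability.
Import Order.TTheory GRing.Theory Num.Theory.

(** * Abelian property *)

Section Lattice.
Variable d : nat.
Local Notation dir := ('I_d * bool)%type.
Implicit Types (x y z w : site d) (a : dir) (V : {fset site d}) (xi eta : config d).

Definition stp a : int := if a.2 then 1 else -1.
Definition nb z a : site d := [ffun j => z j + (if j == a.1 then stp a else 0)].

Lemma nb_inj z : injective (nb z).
Proof.
move=> [i b] [j c] /ffunP H; have := H i; rewrite !ffunE /= eqxx => /addrI.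
case: eqVneq => [->|_]; rewrite /stp /=; last by case: b {H}.
by case: b {H}; case: c.
Qed.

Lemma adjP y w : reflect (exists a, w = nb y a) (adj y w).
Proof.
apply: (iffP (sum_nat_eq1 _ _)) => [[i [_ Hi Hj]]|[[i b] ->]].
  exists (i, y i < w i); apply/ffunP => j; rewrite ffunE /= /stp /=.
  have [->|ji] := eqVneq j i; first by move: Hi; case: ltP => ? ?; lia.
  by have := Hj j ji isT; lia.
exists i; split=> // [|j ji _]; rewrite !ffunE /= /stp /=.
  by rewrite eqxx; case: b; lia.
by rewrite (negbTE ji); lia.
Qed.

Lemma adj_sym y w : adj y w = adj w y.
Proof. by rewrite /adj; congr (_ == _); apply: eq_bigr => i _; rewrite distnC. Qed.

Lemma adj_irr y : adj y y = false.
Proof.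
by rewrite /adj big1 // => i _; rewrite subrr.
Qed.

Lemma sum_nb V (S : nmodType) (F : site d -> S) z :
  \sum_(w : V | adj z (val w)) F (val w) = \sum_(a | nb z a \in V) F (nb z a).
Proof.
have E a : nb z a \in V -> F (nb z a) = \sum_(w : V | val w == nb z a) F (val w).
  by move=> aV; rewrite (big_pred1 [` aV]%fset).
rewrite [RHS](eq_bigr _ E) (exchange_big_dep (fun w : V => adj z (val w))) /=; last first.
  by move=> a w aV /eqP wE; apply/adjP; exists a.
apply: eq_bigr => w /adjP[a0 wE]; rewrite (big_pred1 a0) // => a /=.
apply/andP/eqP => [[_ /eqP wE']|->]; first by apply: (@nb_inj z); rewrite -wE -wE'.
by rewrite -wE fsvalP eqxx.
Qed.

Definition lap (u : site d -> int) y : int := (2 * d)%:Z * u y - \sum_a u (nb y a).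

Lemma lapD u v y : lap (fun w => u w + v w) y = lap u y + lap v y.
Proof. by rewrite /lap big_split /=; ring. Qed.

Lemma lapN u y : lap (fun w => - u w) y = - lap u y.
Proof. by rewrite /lap sumrN; ring. Qed.

Lemma lapZ (c : int) u y : lap (fun w => c * u w) y = c * lap u y.
Proof. by rewrite /lap -mulr_sumr; ring. Qed.

Lemma lap_delta z y : lap (delta z) y = Delta z y.
Proof.
rewrite /lap /Delta /delta; have [->|zy] := eqVneq y z.
  rewrite mulr1 big1 ?subr0 // => a _.
  case: eqP => // E; have : adj z z by apply/adjP; exists a.
  by rewrite adj_irr.
rewrite mulr0 sub0r adj_sym; case: adjP => [[a ->]|na].
  rewrite (bigD1 a) //= eqxx big1 ?addr0 // => b ba.
  by rewrite (inj_eq (@nb_inj y)) (negbTE ba).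
rewrite big1 ?oppr0 // => a _; case: eqP => // E.
by case: na; exists a.
Qed.

Definition cnt (s : seq (site d)) : site d -> int := fun w => (count_mem w s)%:Z.

Lemma cnt_cons z s : cnt (z :: s) = (fun w => delta z w + cnt s w).
Proof. by apply/funext => w; rewrite /cnt /= PoszD /delta eq_sym; case: eqP. Qed.

Lemma topple_seqE V xi s y :
  topple_seq V xi s y = if y \in V then xi y - lap (cnt s) y else xi y.
Proof.
rewrite /topple_seq; elim: s xi => [|z s IH] xi /=.
  by rewrite /lap /cnt /= big1 // mulr0 subrr subr0; case: ifP.
rewrite IH cnt_cons /topple; case: ifP => [yV|->//]; rewrite yV (lapD (delta z)) lap_delta; ring.
Qed.

Lemma topple_seq_cat V xi s t :
  topple_seq V xi (s ++ t) = topple_seq V (topple_seq V xi s) t.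
Proof. by rewrite /topple_seq foldl_cat. Qed.

Lemma legal_seq_cat V xi s t :
  legal_seq V xi (s ++ t) <-> legal_seq V xi s /\ legal_seq V (topple_seq V xi s) t.
Proof.
elim: s xi => [|z s IH] xi /=; first by split=> [|[]].
by rewrite IH; tauto.
Qed.

Lemma legal_sub V xi s : legal_seq V xi s -> {subset s <= V}.
Proof.
elim: s xi => //= z s IH xi [zV [_ /IH sV]] y.
by rewrite inE => /orP[/eqP->|/sV].
Qed.

Lemma legal_addc V xi eta s : (forall y, xi y <= eta y) -> legal_seq V xi s ->
  legal_seq V eta s.
Proof.
elim: s xi eta => //= z s IH xi eta le [zV [hz ls]]; split=> //; split.
  exact: lt_le_trans hz (le z).
apply: IH ls => y; rewrite /topple; case: ifP => // _.
by rewrite lerD2r.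
Qed.

(** At the first toppled site [z], [u z = 0] would leave the height above [2 * d]; so topple [z],
    lower [u z] by one, and recurse. *)
Lemma least_action V xi s (u : site d -> nat) : legal_seq V xi s ->
  (forall y, y \in V -> xi y - lap (fun w => (u w)%:Z) y <= (2 * d)%:Z) ->
  forall y, (count_mem y s <= u y)%N.
Proof.
elim: s xi u => //= z s IH xi u [zV [hz ls]] H y.
have uz : (0 < u z)%N.
  rewrite lt0n; apply/negP => /eqP uz0; have := H z zV; rewrite /lap uz0 mulr0 sub0r opprK.
  have : 0 <= \sum_a (u (nb z a))%:Z by apply: sumr_ge0.
  lia.
pose u' w := if w == z then (u w).-1 else u w.
have u'E w : (u' w)%:Z = (u w)%:Z + - delta z w.
  rewrite /u' /delta; case: eqP => [->|_]; lia.
have HH w : w \in V -> topple V z xi w - lap (fun w => (u' w)%:Z) w <= (2 * d)%:Z.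
  move=> wV; rewrite /topple wV.
  have -> : (fun w => (u' w)%:Z) = (fun w => (u w)%:Z + - delta z w) by apply/funext.
  by rewrite lapD lapN lap_delta; have := H w wV; lia.
have := IH _ u' ls HH y; rewrite /u'; case: eqVneq => [->|nyz] //=; lia.
Qed.

Lemma size_legal V xi s : legal_seq V xi s -> size s = (\sum_(y : V) count_mem (val y) s)%N.
Proof.
move/legal_sub; elim: s => [|z s IH] sV /=; first by rewrite big1.
rewrite big_split /= -IH; last by move=> y ys; apply: sV; rewrite inE ys orbT.
have zV : z \in V by apply: sV; rewrite inE eqxx.
rewrite (bigD1 [` zV]%fset) //= eqxx big1 // => y; rewrite -val_eqE /= eq_sym.
by move/negbTE ->.
Qed.

Lemma legal_subset V W xi eta s : {subset V <= W} -> (forall y, y \in V -> xi y = eta y) ->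
  legal_seq V xi s -> legal_seq W eta s.
Proof.
move=> VW; elim: s xi eta => //= z s IH xi eta E [zV [hz ls]].
split; first exact: VW.
split; first by rewrite -E.
by apply: IH ls => y yV; rewrite /topple yV VW // E.
Qed.

(* [L - |z|^2] is superharmonic, and nonnegative near [V] for large [L]. *)
Lemma superharmonic_exists V : exists u : site d -> nat,
  forall y, y \in V -> (2 * d)%:Z <= lap (fun w => (u w)%:Z) y.
Proof.
pose sq (z : site d) : nat := (\sum_i `|z i| ^ 2)%N.
pose L := (\sum_(y : V) (sq (val y) + \sum_a sq (nb (val y) a)))%N.
exists (fun z => L - sq z)%N => y yV.
have [Ly Ha] : (sq y <= L)%N /\ forall a, (sq (nb y a) <= L)%N.
  rewrite /L (bigD1 [` yV]%fset) //=; split=> [|a]; first by rewrite -addnA leq_addr.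
  by rewrite (bigD1 a) //=; lia.
rewrite /lap.
have sqE z : (sq z)%:Z = \sum_i (z i) ^+ 2.
  by rewrite /sq (big_morph Posz PoszD (erefl _)); apply: eq_bigr => i _;
     rewrite -abszX gez0_abs ?sqr_ge0.
have nbE a : (sq (nb y a))%:Z = (sq y)%:Z + 2 * stp a * y a.1 + 1.
  rewrite !sqE (bigD1 a.1) //= [in RHS](bigD1 a.1) //= ffunE eqxx.
  have -> : \sum_(i | i != a.1) nb y a i ^+ 2 = \sum_(i | i != a.1) y i ^+ 2.
    by apply: eq_bigr => i /negbTE ni; rewrite ffunE ni addr0.
  have : stp a ^+ 2 = 1 by rewrite /stp; case: ifP.
  move: (\sum_(i | _) _) (y a.1) (stp a) => S t s E; nia.
rewrite (eq_bigr (fun a => (L%:Z - (sq y)%:Z - 1) + - 2 * stp a * y a.1)); last first.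
  by move=> a _; have := nbE a; have := Ha a; lia.
rewrite big_split /= sumr_const card_prod card_ord card_bool.
rewrite [X in _ - (_ + X)](_ : _ = 0) ?addr0; last first.
  rewrite -(pair_bigA _ (fun i b => - 2 * stp (i, b) * y i)) /= big1 // => i _.
  by rewrite big_bool /stp /=; ring.
rewrite -mulr_natr -subzn //; lia.
Qed.

Hypothesis d_gt0 : (0 < d)%N.

(** By least action a large multiple of the superharmonic function bounds every legal sequence; a
    longest one stabilizes. *)
Lemma stabilizing_exists V xi : exists s, stabilizing V xi s.
Proof.
have [u0 Hu0] := superharmonic_exists V.
pose k := (\sum_(y : V) `|xi (val y)|)%N.
pose u z := (k * u0 z)%N.
have Hu y : y \in V -> xi y - lap (fun w => (u w)%:Z) y <= (2 * d)%:Z.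
  move=> yV; have -> : (fun w => (u w)%:Z) = (fun w => k%:Z * (u0 w)%:Z).
    by apply/funext => w; rewrite /u PoszM.
  rewrite lapZ; have := Hu0 y yV.
  have : (`|xi y| <= k)%N by rewrite /k (bigD1 [` yV]%fset) //= leq_addr.
  move: (lap _ _) => l; nia.
have bound s : legal_seq V xi s -> (size s <= \sum_(y : V) u (val y))%N.
  by move=> ls; rewrite (size_legal ls); apply: leq_sum => y _; apply: (least_action ls).
pose P n := `[< exists2 s, legal_seq V xi s & size s = n >].
have exP : exists n, P n by exists 0%N; apply/asboolP; exists [::].
have ubP n : P n -> (n <= \sum_(y : V) u (val y))%N by move=> /asboolP[s /bound + <-].
case: (ex_maxnP exP ubP) => n /asboolP[s ls sn] maxn.
exists s; split=> // y yV; rewrite leNgt; apply/negP => hy.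
have : P n.+1.
  apply/asboolP; exists (rcons s y); last by rewrite size_rcons sn.
  by rewrite -cats1; apply/legal_seq_cat.
by move/maxn; rewrite ltnn.
Qed.

Lemma stab_seqP V xi : stabilizing V xi (stab_seq V xi).
Proof. by apply: xgetPex; apply: stabilizing_exists. Qed.

Lemma cnt_stab V xi s : stabilizing V xi s -> cnt s = cnt (stab_seq V xi).
Proof.
have le s1 s2 : stabilizing V xi s1 -> stabilizing V xi s2 ->
    forall y, (count_mem y s1 <= count_mem y s2)%N.
  move=> [l1 _] [l2 st2]; apply: (least_action l1) => y yV.
  by have := st2 y yV; rewrite topple_seqE yV.
move=> st; apply/funext => y; congr Posz; apply/eqP; rewrite eqn_leq.
by rewrite !le //; apply: stab_seqP.
Qed.

Lemma stabilizeE V xi s : stabilizing V xi s -> stabilize V xi = topple_seq V xi s.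
Proof. by move=> /cnt_stab E; apply/funext => y; rewrite /stabilize !topple_seqE E. Qed.

Lemma stabilize_legal V xi s : legal_seq V xi s ->
  stabilize V (topple_seq V xi s) = stabilize V xi.
Proof.
move=> ls; have [lt st] := stab_seqP V (topple_seq V xi s).
rewrite (@stabilizeE V xi (s ++ stab_seq V (topple_seq V xi s))) ?topple_seq_cat //.
by split; [apply/legal_seq_cat|rewrite topple_seq_cat].
Qed.

End Lattice.

(** * Recurrent configurations *)

Section Recurrent.
Variable d : nat.
Local Notation dir := ('I_d * bool)%type.
Implicit Types (a : dir) (V : {fset site d}) (xi eta : config d).

Definition adjV V : rel V := fun v w => adj (val v) (val w).

(** Absence of forbidden subconfigurations, for heights that start at 1. *)
Definition nfsc V xi := forall F : {set V}, F != finset.set0 ->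
  exists2 y, y \in F & (gdeg (@adjV V) F y)%:Z < xi (val y).

Lemma gdeg_nb V (F : {set V}) (y : V) : gdeg (@adjV V) F y =
  (\sum_(a | nb (val y) a \in V) [exists w in F, val w == nb (val y) a])%N.
Proof.
rewrite -(@sum_nb d V nat (fun z => [exists w in F, val w == z] : nat)) /gdeg.
rewrite [RHS]big_mkcond [LHS]big_mkcond; apply: eq_bigr => w _ /=.
rewrite /adjV; case: (adj _ _); last by case: ifP.
case: ifPn => [wF|wF].
  by rewrite (_ : [exists _ in _, _]) //; apply/exists_inP; exists w.
case: exists_inP => // -[w' w'F /eqP /val_inj E]; by rewrite -E w'F in wF.
Qed.

Lemma card_dir : #|{: dir}| = (2 * d)%N.
Proof. by rewrite card_prod card_ord card_bool mulnC. Qed.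

(* Apply the hypothesis on [xi] to the set where [v] is maximal. *)
Lemma nfsc_max_principle V xi (v : site d -> int) : nfsc V xi ->
  (forall y, y \notin V -> v y <= 0) ->
  (forall y, y \in V -> xi y + lap v y <= (2 * d)%:Z) -> forall y, v y <= 0.
Proof.
move=> nf v0 st y0; rewrite leNgt; apply/negP => vy0.
have y0V : y0 \in V by apply/negP => /negP /v0; rewrite leNgt vy0.
have [y1 _ maxy] : exists2 y1 : V, true & forall w : V, v (val w) <= v (val y1).
  exists [arg max_(z > [` y0V]%fset | true) v (val z)]%O => //.
  by case: arg_maxP => // i _ H w; apply: H.
set m := v (val y1) in maxy.
have m0 : 0 < m by apply: lt_le_trans vy0 (maxy [` y0V]%fset).
pose F := [set w : V | v (val w) == m]%SET.
have F0 : F != finset.set0 by apply/set0Pn; exists y1; rewrite inE.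
have [y yF hy] := nf F F0; move: yF; rewrite inE => /eqP vy.
have := st (val y) (valP y); rewrite /lap vy.
suff : \sum_a v (nb (val y) a) <= (2 * d)%:Z * (m - 1) + (gdeg (@adjV V) F y)%:Z by lia.
rewrite gdeg_nb (big_morph Posz PoszD (erefl _)) [X in _ + X]big_mkcond /=.
have -> : (2 * d)%:Z * (m - 1) = \sum_(a : dir) (m - 1).
  by rewrite sumr_const card_dir -mulr_natl natz.
rewrite -big_split; apply: ler_sum => a _ /=.
case: ifPn => aV; last by have := v0 _ aV; lia.
have := maxy [` aV]%fset; rewrite /= le_eqVlt => /orP[/eqP E|]; last by lia.
rewrite E (_ : [exists _ in _, _]); first by lia.
by apply/exists_inP; exists [` aV]%fset; rewrite ?inE /= ?E.
Qed.

Lemma nfsc_le V xi eta : (forall y, y \in V -> xi y <= eta y) -> nfsc V xi -> nfsc V eta.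
Proof.
by move=> le nf F /nf[y yF hy]; exists y => //; apply: lt_le_trans hy (le _ (valP y)).
Qed.

(** If [z] lies in [F], test [F] without [z]: a neighbour of [z] has gained the grain that pays for
    counting [z]. If [F] is only [z], the height left there is still positive. *)
Lemma nfsc_topple V xi z : z \in V -> (2 * d)%:Z < xi z -> nfsc V xi ->
  nfsc V (topple V z xi).
Proof.
move=> zV hz nf F F0; pose zv := [` zV]%fset.
have topE (y : V) : topple V z xi (val y) = xi (val y) - Delta z (val y).
  by rewrite /topple (valP y).
have [zF|zF] := boolP (zv \in F); last first.
  have [y yF hy] := nf F F0; exists y => //; rewrite topE; apply: lt_le_trans hy _.
  have yz : z != val y by apply: contraNneq zF => E; rewrite (_ : zv = y) //; apply: val_inj.
  by rewrite /Delta (negbTE yz); case: ifP => _; rewrite ?opprK ?lerDl ?subr0.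
have [FE|F1] := eqVneq (F :\ zv)%SET finset.set0.
  exists zv => //; rewrite topE /Delta eqxx /gdeg big1 /=; first by lia.
  move=> w wF; have : w \notin (F :\ zv)%SET by rewrite FE inE.
  by rewrite !inE wF andbT negbK => /eqP ->; rewrite /adjV adj_irr.
have [y] := nf _ F1; rewrite !inE => /andP[yz yF] hy; exists y => //.
rewrite topE (gdegD1 _ zF) /Delta.
have zy : z != val y by apply: contraNneq yz => E; apply/eqP/val_inj.
rewrite (negbTE zy) {1}/adjV /= adj_sym; move: hy; case: ifP => _ /=; move: (gdeg _ _ _) (xi _) => g t; lia.
Qed.

Lemma nfsc_topple_seq V xi s : legal_seq V xi s -> nfsc V xi -> nfsc V (topple_seq V xi s).
Proof.
elim: s xi => //= z s IH xi [zV [hz ls]] nf.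
by apply: IH ls _; apply: nfsc_topple.
Qed.

Lemma legal_ge1 V xi s : legal_seq V xi s -> (forall y, y \in V -> 1 <= xi y) ->
  forall y, y \in V -> 1 <= topple_seq V xi s y.
Proof.
elim: s xi => //= z s IH xi [zV [hz ls]] xi1; apply: IH ls _ => y yV.
rewrite /topple yV /Delta; have := xi1 y yV; case: eqVneq => [<-|_]; first by lia.
by case: ifP => _; lia.
Qed.

Hypothesis d_gt0 : (0 < d)%N.

Definition maxc V : config d := fun y => if y \in V then (2 * d)%:Z else 0.

(** A site of [F] with the largest first coordinate has a neighbour outside [F]. *)
Lemma nfsc_maxc V : nfsc V (maxc V).
Proof.
move=> F /set0Pn[y0 y0F]; pose i0 := Ordinal d_gt0.
have [y yF maxy] : exists2 y, y \in F & forall w, w \in F -> val w i0 <= val y i0.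
  exists [arg max_(z > y0 in F) val z i0]%O; first by case: arg_maxP.
  by case: arg_maxP => // i iF H w /H.
exists y => //; rewrite /maxc (valP y) gdeg_nb ltz_nat -card_dir -sum1_card.
rewrite [X in (_ < X)%N](bigD1 (i0, true)) //= add1n ltnS.
rewrite big_mkcond (bigD1 (i0, true)) //=.
rewrite (_ : [exists _ in _, _] = false) /=; last first.
  apply/negbTE/negP => /exists_inP[w wF /eqP wE].
  have := congr1 (fun z : site d => z i0) wE; rewrite ffunE eqxx /stp /= => E.
  have := maxy w wF; rewrite [val w i0]E; move: (fsval y i0) => t; lia.
by case: ifP => _; rewrite add0n; apply: leq_sum => a _; case: ifP => // _; case: [exists _ in _, _].
Qed.

Lemma stabilize_stable V xi : stable_in V xi -> stabilize V xi = xi.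
Proof. by move=> st; rewrite (@stabilizeE d d_gt0 V xi [::]). Qed.

Lemma stabilize_addc V xi g : (forall y, 0 <= g y) ->
  stabilize V (addc (stabilize V xi) g) = stabilize V (addc xi g).
Proof.
move=> g0; have [lt st] := stab_seqP d_gt0 V xi.
rewrite -(@stabilize_legal d d_gt0 V (addc xi g) (stab_seq V xi)).
  congr (stabilize V _); apply/funext => y; rewrite /stabilize /addc !topple_seqE.
  by case: ifP => // _; ring.
by apply: legal_addc lt => y; rewrite /addc lerDl.
Qed.

Lemma reach_trans V xi1 xi2 xi3 : reach V xi1 xi2 -> reach V xi2 xi3 -> reach V xi1 xi3.
Proof. by elim=> // a b c ab _ IH /IH; apply: reach_step. Qed.

Lemma stable_stabilize V xi : stable_in V (stabilize V xi).
Proof. by have [] := stab_seqP d_gt0 V xi. Qed.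

Lemma reach_stabilize V xi s : stable_in V xi -> {subset s <= V} ->
  reach V xi (stabilize V (addc xi (cnt s))).
Proof.
elim: s xi => [|x s IH] xi st sV.
  rewrite (_ : addc _ _ = xi); last by apply/funext => y; rewrite /addc /cnt addr0.
  by rewrite stabilize_stable //; apply: reach_refl.
apply: (@reach_step _ _ _ (addop V x xi)); first by exists x => //; apply: sV; rewrite inE eqxx.
rewrite [addc xi _](_ : _ = addc (addc xi (delta x)) (cnt s)); last first.
  by apply/funext => y; rewrite cnt_cons /addc addrA.
rewrite -stabilize_addc //; apply: IH; first exact: stable_stabilize.
by move=> y ys; apply: sV; rewrite inE ys orbT.
Qed.

Lemma grains V (g : site d -> int) : (forall y, 0 <= g y) -> (forall y, y \notin V -> g y = 0) ->
  exists2 s, {subset s <= V} & cnt s = g.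
Proof.
move=> g0 gV; pose s := flatten [seq nseq `|g (val v)| (val v) | v <- enum {: V}].
have cntE y : count_mem y s = (\sum_(v : V) (val v == y) * `|g (val v)|)%N.
  rewrite /s count_flatten -map_comp sumnE big_map -big_enum /=.
  by apply: eq_bigr => v _; rewrite count_nseq.
exists s.
  move=> y; rewrite -has_pred1 has_count cntE => H; apply/negPn/negP => yV.
  by move: H; rewrite big1 // => v _; case: eqP => // E; rewrite -E fsvalP in yV.
apply/funext => y; rewrite /cnt cntE; have [yV|yV] := boolP (y \in V).
  rewrite (bigD1 [` yV]%fset) //= eqxx mul1n big1 ?addn0 ?gez0_abs // => v.
  by rewrite -val_eqE /= => /negbTE ->.
by rewrite gV // big1 // => v _; case: eqP => // E; rewrite -E fsvalP in yV.
Qed.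

Lemma reach_maxc V xi : in_OmegaV V xi -> reach V xi (maxc V).
Proof.
move=> [xi1 xi0]; have [s sV sE] : exists2 s, {subset s <= V} & cnt s = (fun y => maxc V y - xi y).
  apply: grains => y; rewrite /maxc; last by move=> yV; rewrite (negbTE yV) xi0.
  by case: ifP => [yV|/negbT /xi0 -> //]; have := xi1 y yV; lia.
have -> : maxc V = stabilize V (addc xi (cnt s)).
  rewrite (_ : addc _ _ = maxc V) ?stabilize_stable //; first by move=> y yV; rewrite /maxc yV.
  by apply/funext => y; rewrite /addc sE; ring.
by apply: reach_stabilize => // y /xi1 /andP[].
Qed.

(* Grains added to the maximal configuration give [xi + lap v] with [v >= 0]; by the
   maximum principle, stabilizing undoes all of [v]. *)
Lemma nfsc_reach V xi : in_OmegaV V xi -> nfsc V xi -> reach V (maxc V) xi.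
Proof.
move=> [xi1 xi0] nf; have [u Hu] := superharmonic_exists V.
pose v y : int := if y \in V then (u y)%:Z else 0.
have v0 y : 0 <= v y by rewrite /v; case: ifP.
have Hv y : y \in V -> (2 * d)%:Z <= lap v y.
  move=> yV; apply: le_trans (Hu y yV) _; rewrite /lap (_ : v y = (u y)%:Z) ?lerD2l ?lerN2; last by rewrite /v yV.
  by apply: ler_sum => a _; rewrite /v; case: ifP.
have [s sV sE] : exists2 s, {subset s <= V} &
    cnt s = (fun y => if y \in V then xi y + lap v y - (2 * d)%:Z else 0).
  apply: grains => y; last by move/negbTE ->.
  by case: ifP => // yV; have := xi1 y yV; have := Hv y yV; lia.
pose zeta : config d := addc (maxc V) (cnt s).
have zE y : y \in V -> zeta y = xi y + lap v y.
  by move=> yV; rewrite /zeta /addc sE /maxc yV; ring.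
have [lt st] := stab_seqP d_gt0 V zeta; set t := stab_seq V zeta in lt st.
have tv y : cnt t y <= v y.
  have tn : (count_mem y t <= `|v y|)%N.
    apply: (least_action (u := fun w => `|v w|%N) lt) => z zV; rewrite zE //.
    rewrite (_ : (fun _ => _) = v); first by have := xi1 z zV; lia.
    by apply/funext => w; rewrite gez0_abs.
  by rewrite /cnt -[v y]gez0_abs // lez_nat.
have uz : (fun w => v w + - cnt t w) = fun=> 0.
  apply/funext => y; apply: le_anti; rewrite subr_ge0 tv andbT.
  apply: (nfsc_max_principle nf (v := fun w => v w + - cnt t w)) => z zV.
    by rewrite /v (negbTE zV) add0r oppr_le0.
  by have := st z zV; rewrite topple_seqE zV zE // lapD lapN; lia.
have -> : xi = stabilize V zeta.
  apply/funext => y; rewrite /stabilize topple_seqE; case: ifPn => yV.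
    rewrite zE // -/t; have : lap (fun w => v w + - cnt t w) y = 0.
      by rewrite uz /lap mulr0 big1.
    by rewrite lapD lapN; lia.
  by rewrite xi0 // /zeta /addc /maxc sE (negbTE yV).
by apply: reach_stabilize => // y yV; rewrite /maxc yV.
Qed.

Lemma OmegaV_addop V x xi : x \in V -> in_OmegaV V xi -> in_OmegaV V (addop V x xi).
Proof.
move=> xV [xi1 xi0]; rewrite /addop /stabilize.
have [lt st] := stab_seqP d_gt0 V (addc xi (delta x)).
split=> y yV.
  rewrite st // andbT (legal_ge1 lt) // => z /xi1 /andP[+ _].
  by rewrite /addc /delta; case: eqP; lia.
rewrite topple_seqE (negbTE yV) /addc xi0 // /delta; case: eqP => // E.
by rewrite E xV in yV.
Qed.

Lemma OmegaV_reach V xi xi' : reach V xi xi' -> in_OmegaV V xi -> in_OmegaV V xi'.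
Proof. by elim=> // a b c [x xV ->] _ IH /(OmegaV_addop xV). Qed.

Lemma nfsc_addop V x xi : nfsc V xi -> nfsc V (addop V x xi).
Proof.
move=> nf; have [lt _] := stab_seqP d_gt0 V (addc xi (delta x)).
apply: nfsc_topple_seq lt _; apply: nfsc_le nf => y _.
by rewrite /addc /delta; case: eqP; lia.
Qed.

(** [maxc V] is reachable from everywhere, so the recurrent states are those reachable from it; it
    has no forbidden subconfiguration and the chain creates none. *)
Lemma recurrentE V xi : recurrent V xi <-> in_OmegaV V xi /\ nfsc V xi.
Proof.
split=> [[O rec]|[O nf]]; split=> //.
  have : reach V (maxc V) xi by apply: rec; apply: reach_maxc.
  have := @nfsc_maxc V; move: (maxc V) => eta + r; elim: r => // a b c [x _ ->] _ IH nf.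
  by apply: IH; apply: nfsc_addop.
move=> xi' r; apply: (@reach_trans _ _ (maxc V)); last exact: nfsc_reach.
exact: reach_maxc (OmegaV_reach r O).
Qed.

End Recurrent.

(** * Escape from a cone *)

Section Cone.
Variables (R : realType) (d : nat) (V : {fset site d}).
Local Notation dir := ('I_d * bool)%type.
Local Notation eV := (@adjV d V).

Definition sinks (z : V) : nat := (\sum_a (nb (val z) a \notin V))%N.

Lemma gdeg_sinks z : (gdeg eV finset.setT z + sinks z = 2 * d)%N.
Proof.
rewrite /gdeg /sinks -card_dir -sum1_card.
rewrite (eq_bigr (fun w : V => if adj (val z) (val w) then 1 else 0)%N); last first.
  by move=> w _; rewrite /adjV; case: ifP.
rewrite -big_mkcondr /= (eq_bigl (fun w : V => adj (val z) (val w))); last first.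
  by move=> w; rewrite inE.
rewrite (@sum_nb d V nat (fun=> 1%N)) [X in (X + _)%N]big_mkcond -big_split /=.
by apply: eq_bigr => a _; case: ifP.
Qed.

Lemma adjV_sym : symmetric eV.
Proof. by move=> v w; rewrite /adjV adj_sym. Qed.

Lemma adjV_irr : irreflexive eV.
Proof. by move=> v; rewrite /adjV adj_irr. Qed.

(* Sites outside [V] are part of the sink, of voltage 1. *)
Definition ext (h : V -> R) (z : site d) : R := if insub z is Some v then h v else 1.

Lemma ext_val h (v : V) : ext h (val v) = h v.
Proof. by rewrite /ext valK. Qed.

Lemma ext_out h z : z \notin V -> ext h z = 1.
Proof. by move=> zV; rewrite /ext insubN. Qed.

Variables (U : {set V}) (D : V -> nat) (h : V -> R).
Hypotheses (hV : valid eV sinks (2 * d) U D) (nz : lap_det R eV U D != 0)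
  (hH : harm eV sinks U D h).

Definition inU z := if insub z is Some v then v \in U else true.

Lemma inU_val (v : V) : inU (val v) = (v \in U).
Proof. by rewrite /inU valK. Qed.

Lemma inU_out z : z \notin V -> inU z.
Proof. by move=> zV; rewrite /inU insubN. Qed.

(** Twice the summand of [harm_energy], so that an edge from [z] into [U] has weight 1 and one into
    the sink weight 2. *)
Let energy (z : V) : R := \sum_(w in U) (eV z w)%:R * (h w - h z) ^+ 2 +
  2 * ((sinks z)%:R * (1 - h z) ^+ 2).

Lemma energy_dirs (z : V) (s : seq dir) : uniq s ->
  (forall a, a \in s -> inU (nb (val z) a)) ->
  \sum_(a <- s) (ext h (nb (val z) a) - h z) ^+ 2 <= energy z.
Proof.
move=> us sU; pose f a : R := if nb (val z) a \in V then
  (if inU (nb (val z) a) then (ext h (nb (val z) a) - h z) ^+ 2 else 0) else (1 - h z) ^+ 2.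
have f0 a : 0 <= f a by rewrite /f; case: ifP => _; [case: ifP => _|]; rewrite ?sqr_ge0.
apply: (@le_trans _ _ (\sum_a f a)).
  rewrite big_seq (eq_bigr f).
    rewrite -big_seq big_uniq //= [leRHS](bigID (mem s)) /= lerDl.
    by apply: sumr_ge0.
  by move=> a /sU aU; rewrite /f aU; case: ifPn => // /ext_out ->.
rewrite (bigID (fun a => nb (val z) a \in V)) /= /energy; apply: lerD.
  rewrite (eq_bigr (fun a => if inU (nb (val z) a) then (ext h (nb (val z) a) - h z) ^+ 2 else 0));
    last by move=> a aV; rewrite /f aV.
  rewrite -(@sum_nb d V R (fun w => if inU w then (ext h w - h z) ^+ 2 else 0)).
  rewrite [leLHS]big_mkcond [leRHS]big_mkcond le_eqVlt; apply/orP; left; apply/eqP.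
  apply: eq_bigr => w _; rewrite inU_val ext_val /adjV.
  by case: (adj _ _); case: (w \in U); rewrite ?mul1r ?mul0r.
rewrite (eq_bigr (fun a => (1 - h z) ^+ 2)); last by move=> a /negbTE aV; rewrite /f aV.
rewrite sumr_const -mulr_natl /sinks (_ : #|_| = sinks z).
  have : 0 <= (sinks z)%:R * (1 - h z) ^+ 2 by rewrite mulr_ge0 ?sqr_ge0.
  by rewrite /sinks; lra.
by rewrite /sinks -sum1_card big_mkcond; apply: eq_bigr => a _; rewrite unfold_in /=; case: (_ \in V).
Qed.

(** [D z * h z] is the sum of the neighbouring voltages, the sink included; all are nonnegative, so
    each is bounded by it. *)
Lemma harnack (z : V) a : z \in U -> inU (nb (val z) a) ->
  ext h (nb (val z) a) <= (2 * d)%:R * h z.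
Proof.
move=> zU aU; have h0 := harm_ge0 adjV_sym hV nz hH.
have /andP[_ Dq] := hV zU.
apply: (@le_trans _ _ ((D z)%:R * h z)); last by rewrite ler_wpM2r // ler_nat.
have := hH.2 z zU; rewrite /lapU => /eqP; rewrite subr_eq => /eqP ->.
have S0 : forall w, w \in U -> 0 <= (eV z w)%:R * h w by move=> w _; rewrite mulr_ge0.
have [aV|aV] := boolP (nb (val z) a \in V).
  have E : nb (val z) a = val [` aV]%fset by [].
  rewrite E ext_val (bigD1 [` aV]%fset) /=; last by rewrite -inU_val.
  have -> : eV z [` aV]%fset by apply/adjP; exists a.
  rewrite mul1r addrCA lerDl addr_ge0 // sumr_ge0 // => w /andP[wU _]; exact: S0.
rewrite ext_out // -[leLHS]addr0; apply: lerD; last exact: sumr_ge0.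
by rewrite ler1n /sinks (bigD1 a) //= aV.
Qed.

(** [pt] embeds an octant with apex [y] that avoids the explored set; by [pt_out], its paths stay
    outside [V] once they have left, and the voltage there is 1. *)
Variables (a1 a2 a3 : dir) (pt : nat -> nat -> nat -> site d) (y : V) (L : nat).
Hypotheses (pt0 : pt 0 0 0 = val y)
  (pt1 : forall i j k, pt i.+1 j k = nb (pt i j k) a1)
  (pt2 : forall i j k, pt i j.+1 k = nb (pt i j k) a2)
  (pt3 : forall i j k, pt i j k.+1 = nb (pt i j k) a3)
  (a_uniq : uniq [:: a1; a2; a3])
  (pt_inj : forall i j k i' j' k', pt i j k = pt i' j' k' -> [/\ i = i', j = j' & k = k'])
  (ptU : forall i j k, inU (pt i j k))
  (pt_out : forall i j k a, a \in [:: a1; a2; a3] -> pt i j k \notin V ->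
    nb (pt i j k) a \notin V)
  (pt_far : forall i j k, (L <= i + j + k)%N -> pt i j k \notin V).

Let phi i j k := ext h (pt i j k).

Lemma cone_harnack i j k : phi i j k <= (2 * d)%:R ^+ (i + j + k) * h y.
Proof.
have d0 : (0 < d)%N by case: a1 => -[n n_lt_d] _; apply: leq_trans n_lt_d.
have step i' j' k' a : a \in [:: a1; a2; a3] -> inU (nb (pt i' j' k') a) ->
    ext h (nb (pt i' j' k') a) <= (2 * d)%:R * ext h (pt i' j' k').
  move=> aa aU; have [pV|pV] := boolP (pt i' j' k' \in V).
    have E : pt i' j' k' = val [` pV]%fset by [].
    by rewrite E ext_val; apply: harnack; rewrite -?inU_val -E.
  by rewrite !ext_out ?pt_out // mulr1 ler1n muln_gt0.
have d2 : 0 <= (2 * d)%:R :> R by [].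
elim: k => [|k IH].
  elim: j => [|j IH].
    elim: i => [|i IH]; first by rewrite /phi pt0 ext_val expr0 mul1r.
    rewrite /phi pt1; apply: le_trans (step _ _ _ _ _ _) _; rewrite -?pt1 ?inE ?eqxx //.
    by rewrite !addn0 exprS -mulrA ler_wpM2l //; move: IH; rewrite !addn0.
  rewrite /phi pt2; apply: le_trans (step _ _ _ _ _ _) _; rewrite -?pt2 ?inE ?eqxx ?orbT //.
  by rewrite addnS addSn exprS -mulrA ler_wpM2l.
rewrite /phi pt3; apply: le_trans (step _ _ _ _ _ _) _; rewrite -?pt3 ?inE ?eqxx ?orbT //.
by rewrite addnS exprS -mulrA ler_wpM2l.
Qed.

Lemma cone_grad2 i j k :
  grad2 phi i j k <= \sum_(z | val z == pt i j k) (if z \in U then energy z else 0).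
Proof.
have [pV|pV] := boolP (pt i j k \in V); last first.
  rewrite /grad2 /phi pt1 pt2 pt3 !ext_out ?pt_out ?inE ?eqxx ?orbT //.
  rewrite subrr expr0n /= !addr0 big_pred0 // => z; apply/negbTE/eqP => E.
  by move: pV; rewrite -E fsvalP.
have E : pt i j k = val [` pV]%fset by [].
rewrite (big_pred1 [` pV]%fset); last by move=> z /=; rewrite -val_eqE.
rewrite -inU_val -E ptU.
have := @energy_dirs [` pV]%fset [:: a1; a2; a3] a_uniq; rewrite -E.
rewrite !big_cons big_nil addr0 addrA /grad2 /phi pt1 pt2 pt3 -(ext_val h [` pV]%fset) -E.
by apply=> a; rewrite !inE => /or3P[] /eqP ->; rewrite -?pt1 -?pt2 -?pt3.
Qed.

(** The urn flow finds a point of layer [r] with voltage at least 1/2, and [r] Harnack steps carry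
    this back to [y]. *)
Lemma cone_escape (lam : R) r : 0 < lam -> cond eV sinks U D h <= lam ->
  32 * lam <= r.+1%:R -> 2^-1 / (2 * d)%:R ^+ r <= h y.
Proof.
move=> lam0 Ml Hr.
have HE : \sum_(i < L.+1) \sum_(j < L.+1) \sum_(k < L.+1) grad2 phi i j k <=
    2 * cond eV sinks U D h.
  apply: (@le_trans _ _ (\sum_(z in U) energy z)); last first.
    have := harm_energy adjV_sym hV nz hH; rewrite -(ler_pM2l (ltr0Sn R 1)); apply: le_trans.
    rewrite mulr_sumr le_eqVlt; apply/orP; left; apply/eqP; apply: eq_bigr => z _.
    by rewrite /energy mulrDr mulVKf ?pnatr_eq0.
  have E0 z : 0 <= energy z.
    apply: addr_ge0; last by rewrite mulr_ge0 // mulr_ge0 ?sqr_ge0.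
    apply: sumr_ge0 => w _.
    by rewrite mulr_ge0 ?sqr_ge0.
  rewrite pair_bigA pair_bigA /=.
  apply: (@le_trans _ _ (\sum_(p : 'I_L.+1 * 'I_L.+1 * 'I_L.+1)
    \sum_(z | val z == pt p.1.1 p.1.2 p.2) (if z \in U then energy z else 0))).
    by apply: ler_sum => p _; apply: cone_grad2.
  rewrite (exchange_big_dep xpredT) //= [leRHS]big_mkcond /=; apply: ler_sum => z _.
  have [p0 zE|no] := pickP (fun p : 'I_L.+1 * 'I_L.+1 * 'I_L.+1 => val z == pt p.1.1 p.1.2 p.2).
    rewrite (big_pred1 p0) // => p; apply/eqP/eqP => [E|->]; last exact/eqP/zE.
    have /pt_inj[] := etrans (esym E) (eqP zE).
    clear E zE; case: p p0 => [[i j] k] [[i' j'] k'] /= /val_inj -> /val_inj -> /val_inj -> //.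
  by rewrite big_pred0 //; case: ifP.
have [i [j [k [<- H]]]] := urn_escape lam0 Ml Hr (ltnSn L)
  (fun i j k Lijk => ext_out h (pt_far Lijk)) HE.
have [dd|d0] := posnP d.
  by case: a1 => -[n]; rewrite dd.
rewrite ler_pdivrMr ?exprn_gt0 ?ltr0n ?muln_gt0 // mulrC.
exact: le_trans H (cone_harnack _ _ _).
Qed.

End Cone.

(** * Boxes *)

(** The determinant counts allowed configurations, and the maximal one is allowed. *)
Lemma lap_det_neq0 (R : rcfType) (d : nat) (V : {fset site d}) : (0 < d)%N ->
  lap_det R (@adjV d V) finset.setT (fun=> 2 * d)%N != 0.
Proof.
move=> d_gt0; have q0 : ((2 * d).-1 < 2 * d)%N by rewrite prednK // muln_gt0.
pose c := [ffun=> Ordinal q0] : {ffun V -> 'I_(2 * d)}.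
rewrite -(@card_allowed R _ (@adjV _ V) (2 * d) (@adjV_irr _ _) _ _ c); last first.
  by move=> z _; rewrite leqnn andbT -(gdeg_sinks z) leq_addr.
rewrite pnatr_eq0 -lt0n; apply/card_gt0P; exists c; apply/allowedP; split=> [z|z _|F _ F0].
- by rewrite inE.
- by rewrite ffunE.
- have [y yF H] := nfsc_maxc d_gt0 F0; exists y => //; rewrite ffunE /=.
  by move: H; rewrite /maxc (valP y) ltz_nat; lia.
Qed.

Section Box.
Variables (R : realType) (d : nat) (x : site d).
Local Notation dir := ('I_d * bool)%type.

Definition lev (z : site d) : nat := (\max_i `|z i - x i|)%N.

Lemma lev_leP (z : site d) m : reflect (forall i, (`|z i - x i| <= m)%N) (lev z <= m)%N.
Proof.
by apply: (iffP (bigmax_leqP _ _ _)) => H i; [apply: H|move=> _; apply: H].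
Qed.

Lemma leq_lev (z : site d) i : (`|z i - x i| <= lev z)%N.
Proof. by have /lev_leP := leqnn (lev z). Qed.

Lemma lev0 : lev x = 0%N.
Proof. by apply/eqP; rewrite -leqn0; apply/lev_leP => i; rewrite subrr. Qed.

Lemma lev_adj z w : adj z w -> (lev z <= (lev w).+1)%N.
Proof.
rewrite adj_sym => /adjP[a ->]; apply/lev_leP => i; rewrite ffunE.
have := leq_lev w i; rewrite /stp; case: ifP => _; last by lia.
by case: ifP; lia.
Qed.

Definition box_pt (m : nat) (f : {ffun 'I_d -> 'I_(m.*2.+1)}) : site d :=
  [ffun i => x i - m%:Z + (f i : nat)%:Z].

Definition box (m : nat) : {fset site d} :=
  [fset box_pt f | f in {: {ffun 'I_d -> 'I_(m.*2.+1)}}]%fset.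

Lemma in_box z m : (z \in box m) = (lev z <= m)%N.
Proof.
apply/imfsetP/lev_leP => [[f _ ->] i|H].
  rewrite ffunE; have := ltn_ord (f i).
  by move: (nat_of_ord (f i)) (x i) => k t; lia.
have Hlt i : (`|(z i - x i + m%:Z)%R| < m.*2.+1)%N.
  by have := H i; move: (z i) (x i) => s t; lia.
exists [ffun i => Ordinal (Hlt i)]; rewrite ?inE //.
by apply/ffunP => i; rewrite !ffunE /=; have := H i; move: (z i) (x i) => s t; lia.
Qed.

Hypothesis d_gt2 : (2 < d)%N.

Let d_gt0 : (0 < d)%N. Proof. exact: leq_trans d_gt2. Qed.

(** An octant needs three coordinate directions: here [d >= 3] enters. *)
Lemma two_more (i1 : 'I_d) : exists i2 i3, uniq [:: i1; i2; i3].
Proof.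
have H k : (k < 3)%N -> (k < d)%N by move=> /leq_trans; apply.
pose o0 := Ordinal (H 0%N isT); pose o1 := Ordinal (H 1%N isT); pose o2 := Ordinal (H 2%N isT).
have [E|n0] := eqVneq i1 o0; first by exists o1, o2; rewrite E.
have [E|n1] := eqVneq i1 o1; first by exists o0, o2; rewrite E.
by exists o0, o1; rewrite /= !inE negb_or n0 n1.
Qed.

(** The octant moves away from [x] along [i1] and in the positive sense along [i2] and [i3]; its
    [i1] coordinate keeps it beyond level [l], hence off the explored set. *)
Lemma box_escape m (U : {set box m}) D (h : box m -> R) (lam : R) r (y : box m)
    (i1 : 'I_d) (b : bool) l :
  valid (@adjV _ _) (@sinks _ _) (2 * d) U D -> lap_det R (@adjV _ _) U D != 0 ->
  harm (@adjV _ _) (@sinks _ _) U D h ->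
  0 < lam -> cond (@adjV _ _) (@sinks _ _) U D h <= lam -> 32 * lam <= r.+1%:R ->
  (forall k, k \notin U -> (lev (val k) <= l)%N) ->
  l.+1%:Z <= stp (i1, b) * (val y i1 - x i1) ->
  2^-1 / (2 * d)%:R ^+ r <= h y.
Proof.
move=> hV nz hH lam0 Ml Hr HK yl.
have [i2 [i3]] := two_more i1; rewrite /= !inE negb_or andbT => /andP[/andP[n12 n13] n23].
pose pt (i j k : nat) : site d := [ffun t => val y t +
  (if t == i1 then stp (i1, b) * i%:Z else if t == i2 then j%:Z else if t == i3 then k%:Z else 0)].
have pt_1 i j k : pt i j k i1 = val y i1 + stp (i1, b) * i%:Z by rewrite ffunE eqxx.
have pt_2 i j k : pt i j k i2 = val y i2 + j%:Z.
  by rewrite ffunE eq_sym (negbTE n12) eqxx.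
have pt_3 i j k : pt i j k i3 = val y i3 + k%:Z.
  by rewrite ffunE eq_sym (negbTE n13) eq_sym (negbTE n23) eqxx.
have yb t : (`|val y t - x t| <= m)%N.
  by move: t; apply/lev_leP; rewrite -in_box; exact: (valP y).
have sb : stp (i1, b) = 1 \/ stp (i1, b) = -1 by rewrite /stp /=; case: b {yl pt pt_1 pt_2 pt_3}; auto.
have outP i j k t : (m < `|pt i j k t - x t|)%N -> pt i j k \notin box m.
  by move=> H; rewrite in_box -ltnNge (leq_trans H) ?leq_lev.
pose a1 : dir := (i1, b); pose a2 : dir := (i2, true); pose a3 : dir := (i3, true).
have Npt1 i j k : pt i.+1 j k = nb (pt i j k) a1.
  apply/ffunP => t; rewrite !ffunE /=; case: eqVneq => [->|_]; last by rewrite addr0.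
  by rewrite -addrA; congr (_ + _); rewrite -addn1 PoszD mulrDr mulr1.
have Npt2 i j k : pt i j.+1 k = nb (pt i j k) a2.
  apply/ffunP => t; rewrite !ffunE /=; have [->|n2] := eqVneq t i2.
    by rewrite eq_sym (negbTE n12) /stp /=; lia.
  by rewrite addr0.
have Npt3 i j k : pt i j k.+1 = nb (pt i j k) a3.
  apply/ffunP => t; rewrite !ffunE /=; have [->|n3] := eqVneq t i3.
    by rewrite eq_sym (negbTE n13) eq_sym (negbTE n23) /stp /=; lia.
  by rewrite addr0.
(* If [i + j + k >= 6 * m + 3], one index exceeds [2 * m] and the point has left the box. *)
apply: (@cone_escape R d (box m) U D h hV nz hH a1 a2 a3 pt y (6 * m + 3)) lam0 Ml Hr => //.
- by apply/ffunP => t; rewrite ffunE mulr0; do ![case: ifP => _]; rewrite addr0.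
- by rewrite /= !inE negb_or !xpair_eqE (negbTE n12) (negbTE n13) (negbTE n23).
- move=> i j k i' j' k' /ffunP E; have := E i1; have := E i2; have := E i3.
  rewrite !pt_1 !pt_2 !pt_3 => /addrI[->] /addrI[->] /addrI.
  by case: sb => ->; [rewrite !mul1r => -[->]|rewrite !mulN1r => /oppr_inj[->]].
- move=> i j k; have [ptV|ptV] := boolP (pt i j k \in box m); last exact: inU_out.
  rewrite (_ : pt i j k = val [` ptV]%fset) // inU_val; apply/negPn/negP => /HK /= /lev_leP /(_ i1).
  rewrite pt_1; move: yl; case: sb => ->; lia.
- move=> i j k a aa; rewrite in_box -ltnNge => lm.
  have [t ht] : exists t, (m < `|pt i j k t - x t|)%N.
    apply/existsP; apply: contraLR lm; rewrite -leqNgt => /existsPn H.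
    by apply/lev_leP => t; rewrite leqNgt.
  have {}ht : (m < `|nb (pt i j k) a t - x t|)%N.
    move: aa; rewrite !inE => /or3P[] /eqP ->; rewrite -?Npt1 -?Npt2 -?Npt3.
    + move: ht; have [->|n1] := eqVneq t i1; last by rewrite !ffunE (negbTE n1).
      by rewrite !pt_1; have := yl; have := yb i1; case: sb => ->; lia.
    + move: ht; have [->|n1] := eqVneq t i2; last by rewrite !ffunE (negbTE n1).
      by rewrite !pt_2; have := yb i2; lia.
    + move: ht; have [->|n1] := eqVneq t i3; last by rewrite !ffunE (negbTE n1).
      by rewrite !pt_3; have := yb i3; lia.
  by rewrite in_box -ltnNge (leq_trans ht) ?leq_lev.
- move=> i j k H.
  have [h1|[h1|h1]] : (m.*2 < i)%N \/ (m.*2 < j)%N \/ (m.*2 < k)%N by lia.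
  + by apply: (outP _ _ _ i1); rewrite pt_1; have := yb i1; case: sb => ->; lia.
  + by apply: (outP _ _ _ i2); rewrite pt_2; have := yb i2; lia.
  + by apply: (outP _ _ _ i3); rewrite pt_3; have := yb i3; lia.
Qed.

(** [y'] is the next site outwards from [y] along a coordinate realizing its level. All neighbours
    of [y'] have level above [l], so none was explored before [y]: [D y'] is still [2 * d], and
    removing [y] from [U] makes the edge to [y] live. *)
Lemma level_escape m N (lam : R) r : (N < m)%N -> 0 < lam -> 32 * lam <= r.+1%:R ->
  forall (U : {set box m}) D l y, valid (@adjV _ _) (@sinks _ _) (2 * d) U D -> y \in U ->
  (forall k, k \notin U -> (lev (val k) <= l)%N) -> lev (val y) = l.+1 -> (l.+1 <= N)%N ->
  exists2 y', y' \in (U :\ y)%SET &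
    [/\ 0 < live R (@adjV _ _) (@sinks _ _) (U :\ y) D y', (lev (val y') <= l.+2)%N &
    forall h, lap_det R (@adjV _ _) (U :\ y) D != 0 -> harm (@adjV _ _) (@sinks _ _) (U :\ y) D h ->
      cond (@adjV _ _) (@sinks _ _) (U :\ y) D h <= lam -> 2^-1 / (2 * d)%:R ^+ r <= h y'].
Proof.
move=> Nm lam0 Hr U D l y hV yU HK ly lN.
have [i1 Ei1] : exists i1, lev (val y) = `|val y i1 - x i1|%N.
  by have [|i Hi] := @bigop.eq_bigmax _ (fun i => `|val y i - x i|%N); [rewrite card_ord|exists i].
pose b := x i1 <= val y i1; pose z := nb (val y) (i1, b).
have zi1 : l.+2%:Z <= stp (i1, b) * (z i1 - x i1).
  rewrite /z ffunE eqxx /stp; move: Ei1; rewrite ly /b.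
  by move: (val y i1) (x i1) => s t /=; case: (leP t s); lia.
have adjz : adj (val y) z by apply/adjP; exists (i1, b).
have lz : (lev z <= l.+2)%N by rewrite -ly lev_adj // adj_sym.
have lz' : (l.+2 <= lev z)%N.
  apply: leq_trans (leq_lev z i1); move: zi1; rewrite /stp; case: ifP; lia.
have zV : z \in box m by rewrite in_box (leq_trans lz) // (leq_trans _ Nm).
pose y' : box m := [` zV]%fset.
have y'K k : adj (val y') (val k) -> k \in U.
  move=> /lev_adj H; apply/negPn/negP => /HK kl.
  by have := leq_trans lz' H; rewrite ltnS => /leq_trans/(_ kl); rewrite ltnn.
have y'U : y' \in U.
  by apply/negPn/negP => /HK /= H; have := leq_trans lz' H; rewrite ltnNge leqW.
have y'y : y' != y.
  by apply/eqP => E; move: adjz; rewrite -[z]/(val y') E adj_irr.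
exists y'; first by rewrite !inE y'y.
have gE : gdeg (@adjV _ _) finset.setT y' = gdeg (@adjV _ _) U y'.
  rewrite /gdeg [LHS](bigID (mem U)) /= [X in (_ + X)%N]big1 ?addn0.
    by apply: eq_bigl => k; rewrite !inE.
  by move=> k /andP[_]; rewrite /adjV; case: (boolP (adj _ _)) => // /y'K ->.
have /andP[D1 D2] := hV _ y'U.
have DE : D y' = (2 * d)%N.
  by apply/eqP; rewrite eqn_leq D2 /= -(gdeg_sinks y') gE.
split=> //.
  rewrite /live -addrA -opprD -natrD subr_gt0 ltr_nat DE -(gdeg_sinks y') gE.
  by rewrite (gdegD1 _ yU) /adjV adj_sym adjz ltn_add2r.
move=> h nz hH Ml; apply: (box_escape (i1 := i1) (b := b) (l := l.+1) _ nz hH lam0 Ml Hr) => //.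
- move=> k; rewrite inE => /andP[_ kU]; have /andP[H1 ->] := hV k kU.
  by rewrite andbT (leq_trans _ H1) // leq_add2r gdegS // subD1set.
- move=> k; rewrite in_setD1 negb_and negbK => /orP[/eqP->|/HK/leqW //].
  by rewrite ly.
Qed.

Lemma far_ratio (eps : R) : 0 < eps -> exists2 N, (0 < N)%N & forall m (xv : box m),
  (N < m)%N -> val xv = x -> forall h0,
  #|allowed (@adjV _ _) (finset.setT :\ xv) (fun=> 2 * d)%N h0
     :&: @far _ (@adjV _ _) (2 * d) (fun z => lev (val z)) xv N|%:R
  <= eps * lap_det R (@adjV _ (box m)) finset.setT (fun=> 2 * d)%N.
Proof.
move=> eps0.
have ubnat (t : R) : exists r, t <= r.+1%:R.
  by exists (Num.truncn t); apply/ltW/truncnS_gt.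
(* This makes [M / lam] half of the permitted [eps * M]. *)
pose lam := 2 / eps; have lam0 : 0 < lam by rewrite divr_gt0.
have [r Hr] := ubnat (32 * lam); have [r1 Hr1] := ubnat (32 * 1).
pose c0 : R := 2^-1 / (2 * d)%:R ^+ r; pose c1 : R := 2^-1 / (2 * d)%:R ^+ r1.
have dd n : 0 < 2^-1 / (2 * d)%:R ^+ n :> R.
  by rewrite divr_gt0 ?invr_gt0 ?exprn_gt0 ?ltr0n ?muln_gt0.
have c00 : 0 < c0 by apply: dd.
have c10 : 0 < c1 by apply: dd.
have c1_le1 : c1 <= 1.
  rewrite /c1 ler_pdivrMr ?exprn_gt0 ?ltr0n ?muln_gt0 // mul1r (@le_trans _ _ 1) ?invf_le1 ?ler1n //.
  by rewrite exprn_ege1 // ler1n muln_gt0.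
pose kap := sqrt_gap c0 lam / 2.
have kap0 : 0 < kap.
  apply: divr_gt0 => //; apply: divr_gt0; first exact: exprn_gt0.
  by rewrite mulr_gt0 ?sqrtr_gt0 // mulr_gt0 // addr_gt0 ?exprn_gt0.
have sc1 : 0 < Num.sqrt c1 by rewrite sqrtr_gt0.
(* Chosen so that the square root term of the potential is at most the other half, using
   [Num.sqrt M <= M / Num.sqrt c1]. *)
have [N0 HN] := ubnat (2 / (eps * kap * Num.sqrt c1)).
exists N0.+1 => // m xv Nm xvE h0.
have xvT : xv \in finset.setT by rewrite inE.
have Zge0 U D : valid (@adjV _ _) (@sinks _ (box m)) (2 * d) U D -> 0 <= lap_det R (@adjV _ _) U D.
  by move=> V; rewrite -(card_allowed_valid R (@adjV_irr _ _) h0 V).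
have V1 : valid (@adjV _ _) (@sinks _ (box m)) (2 * d) (finset.setT :\ xv)%SET (fun=> 2 * d)%N.
  by move=> z _; rewrite leqnn andbT -(gdeg_sinks z) leq_add2r gdegS // subsetT.
have nzT := lap_det_neq0 R (box m) d_gt0.
have ZT : 0 <= lap_det R (@adjV _ (box m)) finset.setT (fun=> 2 * d)%N.
  by apply: Zge0 => z _; rewrite gdeg_sinks leqnn.
have [Z0|nz] := eqVneq (lap_det R (@adjV _ _) (finset.setT :\ xv) (fun=> 2 * d)%N) 0.
  apply: (@le_trans _ _ #|allowed (@adjV _ _) (finset.setT :\ xv) (fun=> 2 * d)%N h0|%:R).
    by rewrite ler_nat subset_leq_card // subsetIl.
  by rewrite (card_allowed_valid R (@adjV_irr _ _) h0 V1) Z0 mulr_ge0 // ltW.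
have [h H] := harm_exists (@sinks _ (box m)) nz.
have h_ge0 := harm_ge0 (@adjV_sym _ _) V1 nz H.
have ZE := lap_det_setT (@adjV_sym _ _) (@adjV_irr _ _) (@gdeg_sinks _ _) H nzT.
set M := cond _ _ _ _ _ in ZE.
have HK k : k \notin (finset.setT :\ xv)%SET -> (lev (val k) <= 0)%N.
  by rewrite !inE andbT negbK => /eqP ->; rewrite xvE lev0.
have M0 := cond_ge0 (@adjV_sym _ _) V1 nz H; rewrite -/M in M0.
(* A neighbour of [x] is joined to it by a live edge and, if [M <= 1], has voltage at least [c1];
   otherwise [c1 <= 1 < M]. *)
have c1M : c1 <= M.
  have [M1|/ltW M1] := leP M 1; last exact: le_trans M1.
  pose i0 := Ordinal d_gt0; pose z := nb x (i0, true).
  have adjz : adj x z by apply/adjP; exists (i0, true).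
  have zV : z \in box m.
    have : (lev z <= (lev x).+1)%N by apply: lev_adj; rewrite adj_sym.
    by rewrite lev0 in_box => /leq_trans; apply; apply: leq_ltn_trans Nm.
  pose y : box m := [` zV]%fset.
  have yxv : y != xv by apply/eqP => E; move: adjz; rewrite -xvE -E adj_irr.
  have yU : y \in (finset.setT :\ xv)%SET by rewrite !inE yxv.
  have ly : live R (@adjV _ _) (@sinks _ _) (finset.setT :\ xv) (fun=> 2 * d)%N y = 1.
    rewrite /live -(gdeg_sinks y) (gdegD1 _ xvT) /adjV /= adj_sym xvE adjz !natrD.
    by rewrite mulr1n; ring.
  apply: (@le_trans _ _ (h y)).
    have Hesc := @box_escape m _ _ h 1 r1 y i0 true 0 V1 nz H.
    apply: Hesc M1 Hr1 HK _; first by [].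
    have -> : val y i0 = x i0 + 1 by rewrite -[val y]/z /z ffunE eqxx.
    by rewrite /stp mul1r addrAC subrr.
  rewrite /M /cond [X in _ + X](bigD1 y) //= ly mul1r addrCA lerDl.
  apply: addr_ge0; apply: sumr_ge0 => // w /andP[wU _].
  by rewrite mulr_ge0 // (live_ge0 R V1).
have Mpos : 0 < M by apply: lt_le_trans c1M.
have Z0 : 0 < lap_det R (@adjV _ _) (finset.setT :\ xv) (fun=> 2 * d)%N.
  by rewrite lt_def nz Zge0.
have lip (z w : box m) : adjV z w -> (lev (val z) <= (lev (val w)).+1)%N by apply: lev_adj.
have kapE : 2 * kap <= sqrt_gap c0 lam by rewrite /kap mulrCA divff ?mulr1 ?pnatr_eq0.
have xvU : xv \notin (finset.setT :\ xv)%SET by rewrite !inE eqxx.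
have := card_far_le (@adjV_sym _ _) (@adjV_irr _ _) (@gdeg_sinks _ _) lip lam0 kap0 c00
  (ltn0Sn N0) kapE (level_escape Nm lam0 Hr) h0 V1 xvU HK nz H.
move/le_trans; apply; rewrite -/M.
rewrite ZE mulrA mulrC ler_pM2r //.
have sM : Num.sqrt M <= M / Num.sqrt c1.
  rewrite ler_pdivlMr // -[leRHS](sqr_sqrtr M0) expr2 ler_pM2l ?sqrtr_gt0 //.
  exact: ler_wsqrtr.
have E1 : M / lam = M * eps / 2 by rewrite /lam; field; rewrite gt_eqF.
have E2 : Num.sqrt M / (kap * N0.+1%:R) <= M * eps / 2.
  have n0 : 0 < N0.+1%:R :> R by rewrite ltr0n.
  have kn0 := mulr_gt0 kap0 n0.
  have ek0 := mulr_gt0 (mulr_gt0 eps0 kap0) sc1.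
  rewrite (ler_pdivrMr _ _ kn0); apply: (le_trans sM).
  rewrite (ler_pdivrMr _ _ sc1) -[leLHS]mulr1.
  rewrite [leRHS](_ : _ = M * (eps * kap * Num.sqrt c1 * N0.+1%:R / 2)); last by ring.
  apply: ler_wpM2l => //; rewrite ler_pdivlMr // mul1r mulrC.
  by rewrite -(ler_pdivrMr _ _ ek0).
by rewrite /potential mulr0n mulr0 addr0 E1; apply: le_trans (lerD (lexx _) E2) _; lra.
Qed.

End Box.

(** * Waves *)

Section Waves.
Variables (d : nat) (V : {fset site d}) (lv : site d -> nat) (N : nat).
Hypothesis d_gt0 : (0 < d)%N.
Variable xv : V.
Hypothesis lv_x : (lv (val xv) <= N)%N.
Local Notation x := (val xv).
Implicit Types (C : {set V}) (eta xi : config d).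

(** The event [far] for integer heights, which are one more than their codes. *)
Definition far_config xi := forall C, xv \in C ->
  (forall y, y \notin C -> xi (val y) + (gdeg (@adjV _ V) C y)%:Z <= (2 * d)%:Z) ->
  exists2 z, z \in C & (N < lv (val z))%N.

Definition pre_wave xi := forall y, y \in V -> xi y <= (2 * d)%:Z + (y == x)%:Z.

Definition ind C (z : site d) : nat := [exists w in C, val w == z].

Lemma ind_val C (y : V) : ind C (val y) = (y \in C).
Proof.
congr nat_of_bool; apply/exists_inP/idP => [[w wC /eqP/val_inj <- //]|yC].
by exists y.
Qed.

Lemma lap_ind C (y : V) :
  lap (fun z => (ind C z)%:Z) (val y) = (2 * d)%:Z * (y \in C)%:Z - (gdeg (@adjV _ V) C y)%:Z.
Proof.
rewrite /lap ind_val gdeg_nb; congr (_ - _).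
rewrite (big_morph Posz PoszD (erefl _)) [RHS]big_mkcond; apply: eq_bigr => a _ /=.
case: ifPn => // aV; rewrite /ind; case: exists_inP => // -[w _ /eqP E].
by rewrite -E fsvalP in aV.
Qed.

Lemma gdeg_le C (y : V) : (gdeg (@adjV _ V) C y <= 2 * d)%N.
Proof. by rewrite -(gdeg_sinks y) (leq_trans _ (leq_addr _ _)) // gdegS // finset.subsetT. Qed.

(* A wave topples [x] and then stabilizes [V] minus [x]; by least action it is
   dominated by toppling each site of [C] once. *)
Lemma wave_exists xi C : xv \in C -> pre_wave xi -> xi x = (2 * d)%:Z + 1 ->
  (forall y, y \notin C -> xi (val y) + (gdeg (@adjV _ V) C y)%:Z <= (2 * d)%:Z) ->
  exists w, [/\ legal_seq V xi (x :: w), pre_wave (topple_seq V xi (x :: w)) &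
    forall y, y \in x :: w -> exists2 v, v \in C & val v = y].
Proof.
move=> xC pw xix HC; pose W := (V `\ x)%fset.
have WV : {subset W <= V} by move=> y; rewrite !inE => /andP[].
pose xi1 := topple V x xi; have xV : x \in V := valP xv.
have [ls st] := stab_seqP d_gt0 W xi1; set w := stab_seq W xi1 in ls st.
have wW := legal_sub ls.
have cw y : (count_mem y w <= (if y == x then 0 else ind C y))%N.
  apply: (least_action (u := fun y => if y == x then 0%N else ind C y) ls) => z zW.
  have zV := WV z zW; rewrite /xi1 /topple zV -lap_delta.
  have -> : (fun w : site d => (if w == x then 0%N else ind C w)%:Z) =
            (fun w => (ind C w)%:Z + - delta x w).
    apply/funext => u; rewrite /delta; case: eqP => [->|_]; last by rewrite subr0.
    by rewrite ind_val xC.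
  rewrite lapD lapN -[z]/(val [` zV]%fset) lap_ind.
  have := gdeg_le C [` zV]%fset.
  have := pw z zV; have -> : (z == x) = false by move: zW; rewrite !inE => /andP[/negbTE].
  have [zC|zC] := boolP ([` zV]%fset \in C); first by move: (gdeg _ _ _) => g /=; lia.
  by have := HC _ zC => /=; move: (gdeg _ _ _) => g; lia.
have cx : count_mem x w = 0%N by apply/eqP; rewrite -leqn0 (leq_trans (cw x)) ?eqxx.
exists w; split.
- split=> //; split; first by rewrite xix ltrDl.
  exact: legal_subset WV (fun _ _ => erefl) ls.
- move=> y yV; have [->|yx] := eqVneq y x.
    (* [x] loses [2 * d] grains and regains at most one from each neighbour, since [w] topples no
       site twice. *)
    rewrite topple_seqE xV xix /lap /cnt /= eqxx cx.
    have -> : (true + 0)%N%:Z = 1 by [].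
    set S := \sum_a _; suff : S <= (2 * d)%:Z by move: S => S; lia.
    rewrite {}/S.
    have -> : (2 * d)%:Z = \sum_(a : 'I_d * bool) 1%:Z.
      by rewrite sumr_const card_dir -mulr_natl natz mulr1.
    apply: ler_sum => a _.
    have -> : (x == nb x a) = false.
      by apply/negbTE/eqP => E; have /adjP : exists b, x = nb x b by [exists a]; rewrite adj_irr.
    rewrite add0n lez_nat; apply: leq_trans (cw _) _; case: ifP => // _.
    by rewrite /ind; case: [exists _ in _, _].
  have yW : y \in W by rewrite !inE yx.
  have := st y yW; rewrite !topple_seqE yW yV /= addr0 /xi1 /topple yV.
  by rewrite cnt_cons lapD lap_delta => H; rewrite opprD addrA; exact: H.
- move=> y; rewrite inE => /orP[/eqP->|yw]; first by exists xv.
  have := cw y; case: ifP => _; first by rewrite leqn0 => /eqP/count_memPn; rewrite yw.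
  rewrite /ind; case: exists_inP => [[v vC /eqP vE] _|_]; first by exists v.
  by rewrite leqn0 => /eqP/count_memPn; rewrite yw.
Qed.

(* Take a legal sequence of maximal length among those that consist of full waves
   and stay within level [N]. *)
Lemma far_wave_exists eta y : (forall z, z \in V -> eta z <= (2 * d)%:Z) ->
  (N < lv y)%N -> y \in stab_seq V (addc eta (delta x)) ->
  exists s, let xi := topple_seq V (addc eta (delta x)) s in
   [/\ legal_seq V (addc eta (delta x)) s, pre_wave xi, xi x = (2 * d)%:Z + 1 & far_config xi].
Proof.
move=> st ly yt; set zeta := addc eta (delta x) in yt *; set t := stab_seq V zeta in yt.
have [lt stt] := stab_seqP d_gt0 V zeta; rewrite -/t in lt stt.
pose Q s := [/\ legal_seq V zeta s, pre_wave (topple_seq V zeta s) & forall z, z \in s -> (lv z <= N)%N].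
pose P n := `[< exists2 s, Q s & size s = n >].
have exP : exists n, P n.
  exists 0%N; apply/asboolP; exists [::] => //; split=> // z zV.
  by rewrite /= /zeta /addc /delta; have := st z zV; case: eqP => _; lia.
have ubP n : P n -> (n <= size t)%N.
  move=> /asboolP[s [ls _ _] <-]; rewrite (size_legal ls) (size_legal lt).
  apply: leq_sum => z _; apply: (least_action (u := fun w => count_mem w t) ls) => u uV.
  by have := stt u uV; rewrite topple_seqE uV.
case: (ex_maxnP exP ubP) => n /asboolP[s [ls ps fs] sn] maxn.
exists s => /=; set xi := topple_seq V zeta s in ps *.
have xV : x \in V := valP xv.
have xix : xi x = (2 * d)%:Z + 1.
  apply/eqP; rewrite eq_le; have := ps x xV; rewrite eqxx => -> /=.
  (* If [x] were stable, [s] would be stabilizing and hence contain [y], whose level exceeds [N]. *)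
  rewrite leNgt; apply/negP => xlt.
  have sts : stabilizing V zeta s.
    split=> // z zV; have := ps z zV; case: eqP => [->|_]; last by rewrite addr0.
    by move=> _; rewrite -ltzD1; exact: xlt.
  have := congr1 (fun f => f y) (cnt_stab d_gt0 sts); rewrite /cnt -/t => -[E].
  have ys : y \in s by rewrite -has_pred1 has_count E -has_count has_pred1.
  by have := fs y ys; rewrite leqNgt ly.
split=> // C xC HC; apply: contrapT => nofar.
have [w [lw pw wC]] := wave_exists xC ps xix HC.
have : P (size (s ++ x :: w)).
  apply/asboolP; exists (s ++ x :: w) => //; split.
  - by apply/legal_seq_cat; split.
  - by rewrite topple_seq_cat.
  - move=> z; rewrite mem_cat => /orP[/fs //|/wC[v vC <-]].
    by rewrite leqNgt; apply/negP => lz; apply: nofar; exists v.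
by move/maxn; rewrite size_cat /= sn; lia.
Qed.

End Waves.

(** * The estimate in a box, uniform in its size *)

Section FiniteVolume.
Variables (R : realType) (d : nat).
Hypothesis d_gt2 : (2 < d)%N.
Variable x : site d.

Let d_gt0 : (0 < d)%N. Proof. exact: leq_trans d_gt2. Qed.

Definition toppled_beyond (V : {fset site d}) N (eta : config d) :=
  exists2 y, (N < lev x y)%N & (0 < NV V x y eta)%N.

Lemma embV_val (V : {fset site d}) (xi : OmegaV V) (y : V) : embV xi (val y) = (xi y).+1%:Z.
Proof. by rewrite /embV valK. Qed.

Lemma embV_out (V : {fset site d}) (xi : OmegaV V) y : y \notin V -> embV xi y = 0.
Proof. by move=> yV; rewrite /embV insubN. Qed.

Lemma embV_OmegaV (V : {fset site d}) (xi : OmegaV V) : in_OmegaV V (embV xi).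
Proof.
split=> y yV; last exact: embV_out.
by rewrite -[y]/(val [` yV]%fset) embV_val !lez_nat /=.
Qed.

Lemma RV_allowed (V : {fset site d}) h0 :
  RV V = allowed (@adjV _ V) finset.setT (fun=> 2 * d)%N h0.
Proof.
apply/setP => xi; rewrite inE; apply/asboolP/allowedP => [/(recurrentE d_gt0)[_ nf]|[_ _ nf]].
  split=> [z|z _|F _ /nf[y yF]]; rewrite ?inE //.
  by rewrite embV_val ltz_nat ltnS => H; exists y.
apply/(recurrentE d_gt0); split; first exact: embV_OmegaV.
move=> F F0; have [y yF H] := nf F (finset.subsetT _) F0; exists y => //.
by rewrite embV_val ltz_nat ltnS.
Qed.

Lemma card_RV (V : {fset site d}) : #|RV V|%:R = lap_det R (@adjV _ V) finset.setT (fun=> 2 * d)%N.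
Proof.
have q0 : ((2 * d).-1 < 2 * d)%N by rewrite prednK // muln_gt0.
rewrite (RV_allowed [ffun=> Ordinal q0]) (card_allowed R (@adjV_irr _ _)) // => z _.
by rewrite gdeg_le leqnn.
Qed.

Lemma restrict_embV (V : {fset site d}) (xi : OmegaV V) : Defs.restrict V (embV xi) = embV xi.
Proof. by apply/funext => y; rewrite /Defs.restrict; case: ifPn => // /embV_out ->. Qed.

(* The configuration before the far wave determines the initial one: two initial
   configurations with the same image differ by a Laplacian, so the maximum
   principle applies in both directions. *)
Lemma card_beyond_far m N (xv : box x m) (h0 : {ffun box x m -> 'I_(2 * d)}) : val xv = x ->
  (#|[set xi in RV (box x m) | `[< toppled_beyond (box x m) N (embV xi) >]]%SET| <=
   #|allowed (@adjV _ _) (finset.setT :\ xv) (fun=> 2 * d)%N h0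
     :&: @far _ (@adjV _ _) (2 * d) (fun z => lev x (val z)) xv N|)%N.
Proof.
move=> xvE; set V := box x m in xv h0 xvE *; set B := [set xi in _ | _]%SET.
have q0 : (0 < 2 * d)%N by rewrite muln_gt0.
have lx : (lev x (val xv) <= N)%N by rewrite xvE lev0.
have /choice[S HS] (xi : OmegaV V) : exists s, xi \in B ->
   let eta := addc (embV xi) (delta x) in let chi := topple_seq V eta s in
   [/\ legal_seq V eta s, pre_wave xv chi, chi x = (2 * d)%:Z + 1 & far_config (lev x) N xv chi].
  have [xiB|] := boolP (xi \in B); last by exists [::].
  move: xiB; rewrite inE => /andP[_ /asboolP[y ly]]; rewrite /NV restrict_embV => ny.
  have [|s] := @far_wave_exists d V (lev x) N d_gt0 xv lx (embV xi) y
    (fun z zV => (andP ((embV_OmegaV xi).1 z zV)).2) ly.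
    by rewrite xvE -has_pred1 has_count.
  by rewrite xvE => H; exists s.
pose chi (xi : OmegaV V) := topple_seq V (addc (embV xi) (delta x)) (S xi).
(* The height at [xv], known to be [2 * d + 1], is overwritten by [h0]. On [B] the default of
   [insubd] is never taken, since the other heights lie between 1 and [2 * d]. *)
pose f (xi : OmegaV V) : {ffun V -> 'I_(2 * d)} :=
  [ffun y => if y == xv then h0 y else insubd (Ordinal q0) (`|chi xi (val y)|.-1)%N].
have Bnf xi : xi \in B -> nfsc V (embV xi).
  by rewrite inE => /andP[+ _]; rewrite inE => /asboolP/(recurrentE d_gt0)[].
have chi_nf xi : xi \in B -> nfsc V (chi xi).
  move=> xiB; have [ls _ _ _] := HS xi xiB; apply: (nfsc_topple_seq ls).
  by apply: nfsc_le _ (Bnf xi xiB) => y _; rewrite /addc /delta; case: eqP => _; lia.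
have chi_ge xi y : xi \in B -> y \in V -> 1 <= chi xi y.
  move=> xiB yV; have [ls _ _ _] := HS xi xiB; apply: (legal_ge1 ls) => // z zV.
  have /andP[] := (embV_OmegaV xi).1 z zV.
  by rewrite /addc /delta; case: eqP => _; lia.
have fE xi y : xi \in B -> y != xv -> (f xi y).+1%:Z = chi xi (val y).
  move=> xiB yx; have [_ pw _ _] := HS xi xiB.
  have := pw (val y) (valP y); have := chi_ge xi (val y) xiB (valP y).
  rewrite ffunE (negbTE yx) -/(chi xi) => c1.
  have -> : (val y == val xv) = false by rewrite val_eqE; apply/negbTE.
  rewrite val_insubd; move: (chi _ _) c1 => c c1 c2; case: ifP; lia.
have f_inj : {in B &, injective f}.
  move=> xi xi' xiB xi'B ff.
  have [ls _ cx _] := HS xi xiB; have [ls' _ cx' _] := HS xi' xi'B.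
  have cE y : y \in V -> chi xi y = chi xi' y.
    move=> yV; have [->|yx] := eqVneq y x; first by rewrite /chi cx cx'.
    have yxv : [` yV]%fset != xv by apply: contra_neq yx => E; rewrite -xvE -E.
    by rewrite -[y]/(val [` yV]%fset) -!fE ?ff.
  have out s eta : legal_seq V eta s -> forall y, y \notin V -> cnt s y = 0.
    move=> l y yV; rewrite /cnt (count_memPn _) //.
    by apply: contra yV; apply: legal_sub l _.
  have EE y : y \in V -> embV xi y - lap (cnt (S xi)) y = embV xi' y - lap (cnt (S xi')) y.
    by move=> yV; have := cE y yV; rewrite /chi !topple_seqE yV /addc; lia.
  (* [u] has no forbidden subconfiguration and [u'] is stable, so the maximum principle applies to
     [cnt s' - cnt s]. *)
  have le (u u' : OmegaV V) s s' : nfsc V (embV u) -> legal_seq V (addc (embV u) (delta x)) s ->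
      legal_seq V (addc (embV u') (delta x)) s' ->
      (forall y, y \in V -> embV u y - lap (cnt s) y = embV u' y - lap (cnt s') y) ->
      forall y, cnt s' y <= cnt s y.
    move=> nf l l' E y; rewrite -subr_le0.
    apply: (nfsc_max_principle nf (v := fun y => cnt s' y + - cnt s y)) => z zV.
      by rewrite (out _ _ l) // (out _ _ l').
    rewrite lapD lapN; have /andP[_] := (embV_OmegaV u').1 z zV; have := E z zV; lia.
  have cc : cnt (S xi) = cnt (S xi').
    apply/funext => y; apply: le_anti; apply/andP; split.
      by apply: (le xi' xi) => //; [exact: Bnf|move=> z /EE ->].
    by apply: (le xi xi') => //; exact: Bnf.
  apply/ffunP => y; apply: val_inj => /=; have := EE (val y) (valP y).
  by rewrite cc !embV_val => /addIr[].
rewrite -(card_in_imset f_inj); apply: subset_leq_card; apply/fintype.subsetP => _ /imsetP[xi xiB ->].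
have [ls pw cx fc] := HS xi xiB; rewrite finset.in_setI; apply/andP; split.
  apply/allowedP; split=> [z|z _|F FU F0].
  - by rewrite !inE andbT negbK => /eqP ->; rewrite ffunE eqxx.
  - exact: ltn_ord.
  - have [y yF H] := chi_nf xi xiB F F0; exists y => //; move: H.
    by rewrite -fE // ?ltz_nat ?ltnS //; have := fintype.subsetP FU y yF; rewrite !inE andbT.
apply/farP => C xC HC; apply: (fc C xC) => y yC; rewrite -/(chi xi) -fE //.
  by rewrite -PoszD lez_nat addSn HC.
by apply: contraNneq yC => ->.
Qed.

Lemma finite_volume (eps : R) : 0 < eps -> exists N, forall m, (N < m)%N ->
  #|[set xi in RV (box x m) | `[< toppled_beyond (box x m) N (embV xi) >]]%SET|%:R
    <= eps * #|RV (box x m)|%:R.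
Proof.
move=> /(far_ratio x d_gt2)[N N0 HN]; exists N => m Nm.
have xV : x \in box x m by rewrite in_box lev0.
have q0 : (0 < 2 * d)%N by rewrite muln_gt0.
rewrite card_RV; apply: le_trans (HN m [` xV]%fset Nm erefl [ffun=> Ordinal q0]).
by rewrite ler_nat; apply: card_beyond_far.
Qed.

End FiniteVolume.

(** * Infinite volume *)

Local Open Scope classical_set_scope.

Section InfiniteVolume.
Variables (R : realType) (d : nat) (x : site d).
Hypothesis d_gt2 : (2 < d)%N.

Let d_gt0 : (0 < d)%N. Proof. exact: leq_trans d_gt2. Qed.

(** The toppling numbers in [W] are a competitor in the least action principle for [V]. *)
Lemma NV_mono (V W : {fset site d}) y (eta eta' : config d) : {subset V <= W} ->
  (forall a, a \in V -> eta a = eta' a) -> (NV V x y eta <= NV W x y eta')%N.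
Proof.
move=> VW E; rewrite /NV.
have [ls _] := stab_seqP d_gt0 V (addc (Defs.restrict V eta) (delta x)).
have [lt st] := stab_seqP d_gt0 W (addc (Defs.restrict W eta') (delta x)).
set t := stab_seq W _ in lt st *.
apply: (least_action (u := fun w => count_mem w t) ls) => z zV.
have := st z (VW z zV); rewrite topple_seqE VW // /addc /Defs.restrict zV VW //.
by rewrite E.
Qed.

Lemma box_sub m n : (m <= n)%N -> {subset box x m <= box x n}.
Proof. by move=> mn z; rewrite !in_box => /leq_trans; apply. Qed.

Lemma box_exhausting : exhausting (box x).
Proof.
split=> [n|y]; first by apply/fsubsetP; apply: box_sub.
by exists (lev x y); rewrite in_box.
Qed.

Lemma toppled_beyond_mono m n N (eta eta' : config d) : (m <= n)%N ->
  (forall a, a \in box x m -> eta a = eta' a) ->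
  toppled_beyond x (box x m) N eta -> toppled_beyond x (box x n) N eta'.
Proof.
move=> mn E [y ly ny]; exists y => //; apply: leq_trans ny _.
by apply: NV_mono => //; apply: box_sub.
Qed.

Lemma cylinder_measurable (V : {fset site d}) sigma :
  measurable (cylinder V sigma : set (Omega_meas d)).
Proof. by apply: sub_sigma_algebra; exists V, sigma. Qed.

(** Finitely many integer heights have countably many joint values, so a local event is a countable
    union of cylinders. *)
Lemma local_measurable (V : {fset site d}) (S : set (Omega_meas d)) :
  (forall eta eta' : config d, (forall a, a \in V -> eta a = eta' a) -> S eta -> S eta') ->
  measurable S.
Proof.
move=> loc; pose ex (s : {ffun V -> int}) : config d :=
  fun y => if insub y is Some v then s v else 0.
have -> : S = \bigcup_s (if `[< S (ex s) >] then cylinder V (ex s) else set0).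
  apply/seteqP; split=> [eta Se|eta [s _]]; last first.
    by case: asboolP => // Ss H; apply: loc Ss => a /H.
  pose s := [ffun v : V => eta (val v)].
  have E a : a \in V -> eta a = ex s a.
    by move=> aV; rewrite /ex insubT ffunE.
  by exists s => //; rewrite asboolT //; apply: loc Se.
apply: countable_bigcupT_measurable; first exact: countableP.
by move=> s; case: ifP => _; [exact: cylinder_measurable|exact: measurable0].
Qed.

Definition confined N m : set (Omega_meas d) := [set eta | ~ toppled_beyond x (box x m) N eta].

Lemma confined_measurable N m : measurable (confined N m).
Proof.
apply: (@local_measurable (box x m)) => eta eta' E + H; apply.
by apply: toppled_beyond_mono H => // a /E.
Qed.

Lemma Ntop_gt0 y (eta : config d) :
  (0 < Ntop R x y eta)%E <-> exists m, (0 < NV (box x m) x y eta)%N.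
Proof.
split=> [/ereal_sup_gt[_ [V xV <-]]|[m Hm]].
  rewrite lte_fin ltr0n => ny; exists (\max_(v : V) lev x (val v))%N.
  apply: leq_trans ny _; apply: NV_mono => // v vV; rewrite in_box.
  exact: (@leq_bigmax _ (fun v : V => lev x (val v)) [` vV]%fset).
apply: (@lt_le_trans _ _ ((NV (box x m) x y eta)%:R)%:E); first by rewrite lte_fin ltr0n.
by apply: ereal_sup_ubound; exists (box x m) => //=; rewrite in_box lev0.
Qed.

(** A cluster is finite when it lies in some box; this expresses the event by countably many local
    ones. *)
Lemma finite_clusterE : [set eta : Omega_meas d | finite_set (aval_cluster R x eta)] =
  \bigcup_N \bigcap_m confined N m.
Proof.
apply/seteqP; split=> [eta /= /finite_fsetP[X XE]|eta [N _ HN]] /=.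
  exists (\max_(v : X) lev x (val v))%N => // m _ [y ly ny].
  have yX : y \in X.
    have : [set` X] y by rewrite -XE; apply/Ntop_gt0; exists m.
    by [].
  move: ly; rewrite ltnNge => /negP; apply.
  exact: (@leq_bigmax _ (fun v : X => lev x (val v)) [` yX]%fset).
apply: (@sub_finite_set _ _ [set` box x N]); last exact: finite_fset.
move=> y /Ntop_gt0[m Hm] /=; rewrite in_box leqNgt; apply/negP => ly.
by apply: (HN m I); exists y.
Qed.

(** Either the avalanche passes level [N] in the large box or, by monotonicity, it does not in the
    small one and the restriction is some [sigma]. The second part is a finite sum over cylinders,
    to which weak convergence applies. *)
Lemma card_extend m n N : (m <= n)%N ->
  (#|RV (box x n)| <=
   #|[set xi in RV (box x n) | `[< toppled_beyond x (box x n) N (embV xi) >]]%SET| +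
   \sum_(sigma : OmegaV (box x m) | `[< ~ toppled_beyond x (box x m) N (embV sigma) >])
     #|[set xi in RV (box x n) | `[< forall a, a \in box x m -> embV xi a = embV sigma a >]]%SET|)%N.
Proof.
move=> mn; set W := box x n; set V := box x m; set B := [set xi in _ | _]%SET.
under eq_bigr => sigma _.
  rewrite -sum1_card (eq_bigl (fun xi : OmegaV W => (xi \in RV W) &&
    `[< forall a, a \in V -> embV xi a = embV sigma a >])); last by move=> xi; rewrite inE.
  rewrite big_mkcondr /=; over.
rewrite exchange_big /= -sum1_card (bigID (mem B)) /=; apply: leq_add.
  rewrite -sum1_card [leqLHS](eq_bigl (mem B)) // => xi /=.
  by case: (boolP (xi \in B)) => [|_]; rewrite ?andbF // inE => /andP[->].
rewrite big_mkcondr /=; apply: leq_sum => xi xiR; case: ifPn => // xiB.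
have HB : ~ toppled_beyond x W N (embV xi).
  by move=> H; move: xiB; rewrite inE xiR /= => /negP; apply; apply/asboolP.
have VW (v : V) : val v \in W by apply: (box_sub mn); exact: valP.
pose s0 : OmegaV V := [ffun v => xi [` VW v]%fset].
have E a : a \in V -> embV xi a = embV s0 a.
  move=> aV; rewrite -[a in RHS]/(val [` aV]%fset) embV_val ffunE.
  by rewrite -[a]/(val [` VW [` aV]%fset]%fset) embV_val.
have good0 : `[< ~ toppled_beyond x V N (embV s0) >].
  apply/asboolP => H; apply: HB; apply: toppled_beyond_mono H => // a aV.
  by rewrite E.
by rewrite (bigD1 s0) //= asboolT.
Qed.

(** [confined N m] contains finitely many disjoint cylinders whose total mass is a limit over boxes;
    [finite_volume] bounds it below with an [N] that does not depend on [m]. *)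
Lemma confined_mass (mu : probability (Omega_meas d) R) (eps : R) : 
  (forall Vn : nat -> {fset site d}, exhausting Vn ->
     forall (A : {fset site d}) (sigma : config d),
       (fun n => (muV_cyl R (Vn n) A sigma)%:E) @ \oo --> mu (cylinder A sigma)) ->
  0 < eps -> exists N, forall m, ((1 - eps)%:E <= mu (confined N m))%E.
Proof.
move=> hmu /(finite_volume d_gt2 x)[N HN]; exists N => m.
pose V := box x m; pose good (s : OmegaV V) := `[< ~ toppled_beyond x V N (embV s) >].
pose A : {fset OmegaV V} := [fset s in {: OmegaV V} | good s]%fset.
pose F (s : OmegaV V) : set (Omega_meas d) := cylinder V (embV s).
have FF : trivIset [set` A] F.
  move=> s s' _ _ [eta [H H']]; apply/ffunP => v; apply: val_inj.
  have := H (val v) (valP v); rewrite (H' (val v) (valP v)) !embV_val => -[E].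
  by rewrite /= E.
have mF s : measurable (F s) by apply: cylinder_measurable.
apply: (@le_trans _ _ (mu (\big[setU/set0]_(s <- A) F s))); last first.
  apply: le_measure; rewrite ?inE.
  - exact: bigsetU_measurable.
  - exact: confined_measurable.
  rewrite -bigcup_fset => eta [s /= sA Hs] H.
  have : good s by move: sA; rewrite !inE.
  by move/asboolP; apply; apply: toppled_beyond_mono H => // a /Hs.
rewrite measure_fbigsetU //.
have cv : (\sum_(s <- A) (muV_cyl R (box x n) V (embV s))%:E)%E @[n --> \oo] -->
    (\sum_(s <- A) mu (F s))%E.
  apply: cvg_nnesum => [s _|s _]; last exact: (hmu _ box_exhausting V (embV s)).
  by near=> n; rewrite lee_fin divr_ge0.
apply: cvge_ge cv; near=> n.
have Nn : (N < n)%N by near: n; exact: nbhs_infty_gt.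
have mn : (m <= n)%N by near: n; exact: nbhs_infty_ge.
rewrite sumEFin lee_fin /muV_cyl -mulr_suml.
have R0 : 0 < #|RV (box x n)|%:R :> R.
  by rewrite lt_def ler0n andbT card_RV ?lap_det_neq0.
rewrite ler_pdivlMr // mulrBl mul1r lerBlDl.
have := card_extend N mn; rewrite -(ler_nat R) natrD natr_sum => /le_trans; apply.
apply: lerD; first exact: HN.
rewrite le_eqVlt; apply/orP; left; apply/eqP.
by rewrite /A big_fset /= big_enum_cond.
Unshelve. all: by end_near.
Qed.

End InfiniteVolume.

Theorem theorem3p2 (R : realType) (d : nat) (hd : (3 <= d)%N)
  (mu : probability (Omega_meas d) R)
  (hmu : forall Vn : nat -> {fset site d}, exhausting Vn ->
     forall (A : {fset site d}) (sigma : config d),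
       (fun n => (muV_cyl R (Vn n) A sigma)%:E) @ \oo
         --> mu (cylinder A sigma))
  (x : site d) :
  measurable [set eta : Omega_meas d | finite_set (aval_cluster R x eta)] /\
  mu [set eta : Omega_meas d | finite_set (aval_cluster R x eta)] = 1%E.
Proof.
rewrite finite_clusterE //.
have mI N : measurable (\bigcap_m confined x N m).
  by apply: bigcap_measurable => [|m _]; [exists 0%N|apply: confined_measurable].
have mU : measurable (\bigcup_N \bigcap_m confined x N m) by apply: bigcup_measurable.
split=> //; apply/eqP; rewrite eq_le probability_le1 //=.
apply/lee_addgt0Pr => eps eps0; rewrite -leeBlDr // -EFinB.
have [N HN] := confined_mass x hd hmu eps0.
apply: (@le_trans _ _ (mu (\bigcap_m confined x N m))); last first.
  by apply: le_measure; rewrite ?inE // => eta H; exists N.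
(* The events decrease in [m], so continuity from above keeps the bound for all [m] at once. *)
have cv : mu \o confined x N @ \oo --> mu (\bigcap_m confined x N m).
  apply: nonincreasing_cvg_mu => //.
  - by apply: (le_lt_trans (probability_le1 _ _)) => //; rewrite ?ltry //; apply: confined_measurable.
  - by move=> m; apply: confined_measurable.
  - move=> m n mn; apply/subsetPset => eta H H'; apply: H.
    by apply: toppled_beyond_mono H'.
by apply: cvge_ge cv; near=> m; exact: HN.
Unshelve. all: by end_near.
Qed.
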